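(* Let $\mathcal T$ be a balanced CStree on the variables $X_1,\dots,X_p$ (so that $\mathcal M(\mathcal T)$ is a decomposable CSmodel). A distribution $f\in\Delta^\circ_{|\mathcal R|-1}$ factorizes according to $\mathcal T$ (i.e. $f\in\mathcal M(\mathcal T)$) if and only if all polynomials associated to the saturated CSI statements in $\mathcal J(\mathcal T)$ vanish at $f$. Moreover, the polynomials associated to the saturated CSI statements in $\mathcal J(\mathcal T)$ form a Markov basis of $\mathcal M(\mathcal T)$.
   Context: Notation. $[p]=\{1,\dots,p\}$; $X_1,\dots,X_p$ are discrete random variables, $X_i$ with state space $[d_i]=\{1,\dots,d_i\}$. For $A\subseteq[p]$ let $\mathcal R_A=\prod_{i\in A}[d_i]$, $\mathcal R=\mathcal R_{[p]}$. For $\mathbf x\in\mathcal R_B$ and $A\subseteq B$, $\mathbf x_A=(x_i)_{i\in A}$; for disjoint $A,B$, $\mathbf x_A\mathbf x_B\in\mathcal R_{A\cup B}$ is the combined outcome. $\Delta^\circ_{|\mathcal R|-1}$ is the set of $f=(f(\mathbf x))_{\mathbf x\in\mathcal R}$ with all $f(\mathbf x)>0$ and $\sum_{\mathbf x}f(\mathbf x)=1$. $\mathbb R[D]=\mathbb R[p_{\mathbf x}:\mathbf x\in\mathcal R]$. CStrees. Let $\mathcal T=(V,E)$ be the rooted tree with $V=\{\mathrm{root}\}\cup\bigcup_{j\in[p]}\mathcal R_{[j]}$ and edges $\mathrm{root}\to x_1$ and $x_1\cdots x_{k-1}\to x_1\cdots x_k$. Its $k$-th level is $L_k=\mathcal R_{[k]}$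 ($L_0=\{\mathrm{root}\}$); $E(v)$ is the set of outgoing edges of $v$. A labeling $\theta:E\to\mathcal L$ ($\mathcal L$ a finite set) makes $\mathcal T$ a staged tree if $|\theta(E(v))|=|E(v)|$ for all $v$, and $\theta(E(v)),\theta(E(w))$ are equal or disjoint for all $v,w$. Non-leaf vertices $v,w$ are in the same stage iff $\theta(E(v))=\theta(E(w))$; the equivalence classes are the stages (leaves are regarded as singleton stages). A staged tree is a CStree if: (1) $\theta(E(v))\ne\theta(E(w))$ for non-leaf $v,w$ in different levels; (2) $\theta(x_1\cdots x_{k-1}\to x_1\cdots x_{k-1}x_k)=\theta(y_1\cdots y_{k-1}\to y_1\cdots y_{k-1}x_k)$ whenever $x_1\cdots x_{k-1}$ and $y_1\cdots y_{k-1}$ are in the same stage; (3) for every $k\in[p]$ and every stage $S\subseteq L_{k-1}$ there are $C\subseteq[k-1]$ and $\mathbf x_C\in\mathcal R_C$ with $S=\{\mathbf x_C\mathbf y:\mathbf y\in\mathcal R_{[k-1]\setminus C}\}$. Model. $\mathcal M(\mathcal T)\subseteq\Delta^\circ_{|\mathcal R|-1}$ is the set of all $f$ of the form $f(\mathbf x)=\prod_{e\in E(\mathrm{root}\to\mathbf x)}x_{\theta(e)}$, where $E(\mathrm{root}\to\mathbf x)$ is the set of edges of the path from the root to the leaf $\mathbf x$, the parameters $x_{\theta(e)}\in(0,1)$ are indexed by labels, and $\sum_{e\in E(v)}x_{\theta(e)}=1$ for each non-leaf $v$. Such $f$ are said to factorize according to $\mathcal T$. Balanced. For a vertex $v\in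 L_{k-1}$ let $t(v)=\sum_{\mathbf z\in\mathcal R_{[p]\setminus[k-1]}}\prod_{e\in E(v\to v\mathbf z)}\theta(e)$ in the polynomial ring $\mathbb R[\theta(e):e\in E]$ whose variables are the labels ($E(v\to v\mathbf z)$: edges on the path from $v$ to $v\mathbf z$). $\mathcal T$ is balanced if for every $k\in[p]$, all $v,w\in L_{k-1}$ in the same stage and all $s,r\in[d_k]$: $t(vs)t(wr)=t(vr)t(ws)$ in $\mathbb R[\theta(e):e\in E]$. A decomposable CSmodel is a model $\mathcal M(\mathcal T)$ with $\mathcal T$ a balanced CStree. CSI statements. For pairwise disjoint $A,B,S,C\subseteq[p]$ and $\mathbf x_C\in\mathcal R_C$, the CSI statement $X_A\perp X_B\mid X_S,X_C=\mathbf x_C$ is the condition $f(\mathbf x_A|\mathbf x_B,\mathbf x_S,\mathbf x_C)=f(\mathbf x_A|\mathbf x_S,\mathbf x_C)$ for all $\mathbf x_A,\mathbf x_B,\mathbf x_S$ (trivial if $A$ or $B$ is empty). It is saturated if $A\cup B\cup S\cup C=[p]$. The polynomials associated to a saturated statement are $p_{\mathbf x_A\mathbf x_B\mathbf x_S\mathbf x_C}p_{\mathbf y_A\mathbf y_B\mathbf x_S\mathbf x_C}-p_{\mathbf x_A\mathbf y_B\mathbf x_S\mathbf x_C}p_{\mathbf y_A\mathbf x_B\mathbf x_S\mathbf x_C}$ for all $\mathbf x_A,\mathbf y_A\in\mathcal R_A$, $\mathbf x_B,\mathbf y_B\in\mathcal R_B$, $\mathbf x_S\in\mathcal R_S$.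 $\mathcal J(\mathcal T)$. For a stage $S\subseteq L_{k-1}$ let $C\subseteq[k-1]$ be the set of indices at which all elements of $S$ agree and $\mathbf x_C$ the common value; the stage statement is $X_k\perp X_{[k-1]\setminus C}\mid X_C=\mathbf x_C$. $\mathcal J(\mathcal T)$ is the set of all CSI statements derivable from the stage statements by the CSI axioms (all index sets disjoint): symmetry: $A\perp B|S,\mathbf x_C\Rightarrow B\perp A|S,\mathbf x_C$; decomposition: $A\perp B\cup D|S,\mathbf x_C\Rightarrow A\perp B|S,\mathbf x_C$; weak union: $A\perp B\cup D|S,\mathbf x_C\Rightarrow A\perp B|S\cup D,\mathbf x_C$; contraction: $A\perp B|S\cup D,\mathbf x_C$ and $A\perp D|S,\mathbf x_C\Rightarrow A\perp B\cup D|S,\mathbf x_C$; intersection: $A\perp B|S\cup D,\mathbf x_C$ and $A\perp S|B\cup D,\mathbf x_C\Rightarrow A\perp B\cup S|D,\mathbf x_C$; specialization: $A\perp B|S,\mathbf x_C$, $T\subseteq S$, $\mathbf x_T\in\mathcal R_T\Rightarrow A\perp B|S\setminus T,\mathbf x_{T\cup C}$; absorption: if for some $T\subseteq C$ one has $A\perp B|S,\mathbf x_{C\setminus T}\mathbf x_T$ for all $\mathbf x_T\in\mathcal R_T$, then $A\perp B|S\cup T,\mathbf x_{C\setminus T}$. (Here $A\perp B|S,\mathbf x_C$ abbreviates $X_A\perp X_B|X_S,X_C=\mathbf x_C$.) Markov basis. A Markov basis of $\mathcal M(\mathcal T)$ (a log-linear model when $\mathcal T$ is balanced) is a finite set of binomials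 generating its toric ideal, i.e. the ideal of $\mathbb R[D]$ generated by all homogeneous polynomials vanishing on $\mathcal M(\mathcal T)$. *)

(* Defs.v *)
From HB Require Import structures.
From mathcomp Require Import all_boot all_order all_algebra.
From mathcomp Require Import classical_sets cardinality reals.
From mathcomp Require Export mpoly.

Set Implicit Arguments.
Unset Strict Implicit.
Unset Printing Implicit Defensive.

Import Order.TTheory GRing.Theory Num.Theory.
Local Open Scope ring_scope.

(* The variables X_1, ..., X_p are indexed by i : 'I_p, the state space [d_i]
   is 'I_(d i), and the set of all joint outcomes (written R_[p] in the
   comments below) is [outcome d].
   An element of R_A is a partial assignment with domain A; in this way
   elements of R_A and R_B can be restricted and combined without casts. *)

Definition outcome (p : nat) (d : 'I_p -> nat) : finType :=
  {dffun forall i : 'I_p, 'I_(d i)}.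

Definition passign (p : nat) (d : 'I_p -> nat) : finType :=
  {dffun forall i : 'I_p, option 'I_(d i)}.

Definition dom (p : nat) (d : 'I_p -> nat) (c : passign d) : {set 'I_p} :=
  [set i | c i != None].

Definition Rset (p : nat) (d : 'I_p -> nat) (A : {set 'I_p}) :
  {set passign d} := [set c | dom c == A].

(* x_A for x in R_[p] *)
Definition restr (p : nat) (d : 'I_p -> nat) (A : {set 'I_p}) (x : outcome d) :
  passign d := [ffun i => if i \in A then Some (x i) else None].

(* x_A x_B, used only when the domains A and B are disjoint *)
Definition glue (p : nat) (d : 'I_p -> nat) (a b : passign d) : passign d :=
  [ffun i => if a i is Some s then Some s else b i].

(* The index set {1, ..., k}, which is {0, ..., k - 1} in 'I_p. *)
Definition below (p k : nat) : {set 'I_p} := [set i : 'I_p | (i < k)%N].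

(* The level L_k = R_[k] of the tree, for k <= p. *)
Definition level (p : nat) (d : 'I_p -> nat) (k : nat) : finType :=
  {v : passign d | dom v == below p k}.

Lemma dom_restr (p : nat) (d : 'I_p -> nat) (A : {set 'I_p}) (x : outcome d) :
  dom (restr A x) == A.
Proof. by apply/eqP/setP => i; rewrite inE ffunE; case: ifP. Qed.

Definition prefix (p : nat) (d : 'I_p -> nat) (k : nat) (x : outcome d) :
  level d k := exist _ (restr (below p k) x) (dom_restr (below p k) x).

Definition extend (p : nat) (d : 'I_p -> nat) (v : passign d) (k : 'I_p)
  (s : 'I_(d k)) : passign d :=
  [ffun i => dfwith (T := fun j => option 'I_(d j)) v (Some s) i].

Lemma dom_extend (p : nat) (d : 'I_p -> nat) (k : 'I_p) (v : level d k)
  (s : 'I_(d k)) : dom (extend (val v) s) == below p k.+1.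
Proof.
apply/eqP/setP => i; rewrite !inE ffunE ltnS.
have [<-|nki] := eqVneq k i; first by rewrite dfwith_in leqnn.
rewrite dfwith_out // leq_eqVlt.
have -> : (i == k :> nat) = false by apply/negbTE; rewrite eq_sym.
by have /eqP/setP/(_ i) := valP v; rewrite !inE.
Qed.

(* The vertex vs, a child of v. *)
Definition child (p : nat) (d : 'I_p -> nat) (k : 'I_p) (v : level d k)
  (s : 'I_(d k)) : level d k.+1 := exist _ (extend (val v) s) (dom_extend v s).

(* An edge v -> vs of the tree, with v in L_k (k < p), is given by k, v and s;
   a labeling theta : E -> L is therefore curried. *)
Definition labeling (p : nat) (d : 'I_p -> nat) (L : finType) : Type :=
  forall k : 'I_p, level d k -> 'I_(d k) -> L.

Definition labels (p : nat) (d : 'I_p -> nat) (L : finType)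
  (theta : labeling d L) (k : 'I_p) (v : level d k) : {set L} :=
  [set theta k v s | s : 'I_(d k)].

(* |E(v)| = d k for v in L_k. *)
Definition staged_tree (p : nat) (d : 'I_p -> nat) (L : finType)
  (theta : labeling d L) : Prop :=
  (forall (k : 'I_p) (v : level d k), #|labels theta v| = d k) /\
  (forall (k l : 'I_p) (v : level d k) (w : level d l),
     labels theta v = labels theta w \/
     [disjoint labels theta v & labels theta w]).

(* The vertices of L_k in the stage of v; in a CStree this is the whole stage,
   as vertices of different levels are in different stages. *)
Definition stage (p : nat) (d : 'I_p -> nat) (L : finType)
  (theta : labeling d L) (k : 'I_p) (v : level d k) : {set level d k} :=
  [set w | labels theta w == labels theta v].

Definition CStree (p : nat) (d : 'I_p -> nat) (L : finType)
  (theta : labeling d L) : Prop :=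
  [/\ staged_tree theta,
      forall (k l : 'I_p) (v : level d k) (w : level d l),
        k != l -> labels theta v <> labels theta w,
      forall (k : 'I_p) (v w : level d k) (s : 'I_(d k)),
        labels theta v = labels theta w -> theta k v s = theta k w s &
      forall (k : 'I_p) (v : level d k),
        exists (C : {set 'I_p}) (c : passign d),
          [/\ C \subset below p k, c \in Rset d C &
              [set val w | w in stage theta v] =
              [set glue c y | y in Rset d (below p k :\: C)]]].

Definition path_label (p : nat) (d : 'I_p -> nat) (L : finType)
  (theta : labeling d L) (x : outcome d) (k : 'I_p) : L :=
  theta k (prefix k x) (x k).

Definition open_simplex (R : realType) (p : nat) (d : 'I_p -> nat)
  (f : outcome d -> R) : Prop :=
  (forall x, 0 < f x) /\ \sum_x f x = 1.

Definition in_model (R : realType) (p : nat) (d : 'I_p -> nat) (L : finType)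
  (theta : labeling d L) (f : outcome d -> R) : Prop :=
  exists y : L -> R,
    [/\ forall (k : 'I_p) (v : level d k) (s : 'I_(d k)),
          0 < y (theta k v s) < 1,
        forall (k : 'I_p) (v : level d k),
          \sum_(s < d k) y (theta k v s) = 1 &
        forall x, f x = \prod_(k < p) y (path_label theta x k)].

(* t(v) for v in L_k: the outcomes vz, with z in R_([p] \ [k]), are exactly the
   x in R_[p] whose k-th prefix is v. The variables of the ring are the
   elements of L. *)
Definition tpoly (R : realType) (p : nat) (d : 'I_p -> nat) (L : finType)
  (theta : labeling d L) (k : nat) (v : level d k) : {mpoly R[#|L|]} :=
  \sum_(x : outcome d | prefix k x == v)
    \prod_(j < p | (k <= j)%N) 'X_(enum_rank (path_label theta x j)).

Definition balanced (R : realType) (p : nat) (d : 'I_p -> nat) (L : finType)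
  (theta : labeling d L) : Prop :=
  forall (k : 'I_p) (v w : level d k) (s r : 'I_(d k)),
    labels theta v = labels theta w ->
    tpoly R theta (child v s) * tpoly R theta (child w r) =
    tpoly R theta (child v r) * tpoly R theta (child w s).

(* The CSI statement X_A _||_ X_B | X_S, X_C = x_C is CSI A B S c with c = x_C,
   so that C = dom c. *)
Record csi (p : nat) (d : 'I_p -> nat) : Type := CSI {
  csi_left : {set 'I_p};
  csi_right : {set 'I_p};
  csi_cond : {set 'I_p};
  csi_ctx : passign d }.

Definition saturated (p : nat) (d : 'I_p -> nat) (s : csi d) : Prop :=
  csi_left s :|: csi_right s :|: csi_cond s :|: dom (csi_ctx s) = [set: 'I_p].

Definition pairwise_disjoint (p : nat) (As : seq {set 'I_p}) : bool :=
  pairwise (fun A B : {set 'I_p} => [disjoint A & B]) As.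

(* The assignment x_C of the coordinates on which all elements of the stage of
   v agree. *)
Definition stage_context (p : nat) (d : 'I_p -> nat) (L : finType)
  (theta : labeling d L) (k : 'I_p) (v : level d k) : passign d :=
  [ffun i => if [forall w in stage theta v, val w i == val v i]
             then val v i else None].

Definition stage_statement (p : nat) (d : 'I_p -> nat) (L : finType)
  (theta : labeling d L) (k : 'I_p) (v : level d k) : csi d :=
  let c := stage_context theta v in
  CSI [set k] (below p k :\: dom c) finset.set0 c.

Inductive JT (p : nat) (d : 'I_p -> nat) (L : finType)
  (theta : labeling d L) : csi d -> Prop :=
| JT_stage (k : 'I_p) (v : level d k) :
    JT theta (stage_statement theta v)
| JT_symmetry (A B S : {set 'I_p}) (c : passign d) :
    pairwise_disjoint [:: A; B; S; dom c] ->
    JT theta (CSI A B S c) -> JT theta (CSI B A S c)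
| JT_decomposition (A B D S : {set 'I_p}) (c : passign d) :
    pairwise_disjoint [:: A; B; D; S; dom c] ->
    JT theta (CSI A (B :|: D) S c) -> JT theta (CSI A B S c)
| JT_weak_union (A B D S : {set 'I_p}) (c : passign d) :
    pairwise_disjoint [:: A; B; D; S; dom c] ->
    JT theta (CSI A (B :|: D) S c) -> JT theta (CSI A B (S :|: D) c)
| JT_contraction (A B D S : {set 'I_p}) (c : passign d) :
    pairwise_disjoint [:: A; B; D; S; dom c] ->
    JT theta (CSI A B (S :|: D) c) -> JT theta (CSI A D S c) ->
    JT theta (CSI A (B :|: D) S c)
| JT_intersection (A B D S : {set 'I_p}) (c : passign d) :
    pairwise_disjoint [:: A; B; D; S; dom c] ->
    JT theta (CSI A B (S :|: D) c) -> JT theta (CSI A S (B :|: D) c) ->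
    JT theta (CSI A (B :|: S) D c)
| JT_specialization (A B S T : {set 'I_p}) (c xT : passign d) :
    pairwise_disjoint [:: A; B; S; dom c] ->
    T \subset S -> xT \in Rset d T ->
    JT theta (CSI A B S c) -> JT theta (CSI A B (S :\: T) (glue xT c))
(* Here c is x_(C \ T) and the original context set C is dom c :|: T. *)
| JT_absorption (A B S T : {set 'I_p}) (c : passign d) :
    pairwise_disjoint [:: A; B; S; T; dom c] ->
    (forall xT : passign d, xT \in Rset d T ->
       JT theta (CSI A B S (glue c xT))) ->
    JT theta (CSI A B (S :|: T) c).

(* The ring R[D], with one variable for each outcome. *)
Definition pring (R : realType) (p : nat) (d : 'I_p -> nat) :=
  {mpoly R[#|outcome d|]}.

Definition pvar (R : realType) (p : nat) (d : 'I_p -> nat) (x : outcome d) :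
  pring R d := 'X_(enum_rank x).

Definition peval (R : realType) (p : nat) (d : 'I_p -> nat)
  (f : outcome d -> R) (q : pring R d) : R := q.@[fun i => f (enum_val i)].

(* x with its B-coordinates replaced by those of y *)
Definition swap (p : nat) (d : 'I_p -> nat) (B : {set 'I_p})
  (x y : outcome d) : outcome d := [ffun i => if i \in B then y i else x i].

(* The pairs (x_A x_B x_S x_C, y_A y_B x_S x_C) for a saturated statement are
   the pairs of outcomes (x, y) which extend x_C and agree on S. *)
Definition csi_polys (R : realType) (p : nat) (d : 'I_p -> nat) (s : csi d) :
  pring R d -> Prop := fun g =>
  exists x y : outcome d,
    [/\ restr (dom (csi_ctx s)) x = csi_ctx s,
        restr (dom (csi_ctx s)) y = csi_ctx s,
        restr (csi_cond s) x = restr (csi_cond s) y &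
        g = pvar R x * pvar R y
            - pvar R (swap (csi_right s) x y)
              * pvar R (swap (csi_right s) y x)].

Definition saturated_polys (R : realType) (p : nat) (d : 'I_p -> nat)
  (L : finType) (theta : labeling d L) : pring R d -> Prop := fun g =>
  exists s : csi d, [/\ JT theta s, saturated s & csi_polys s g].

Definition ideal_gen (A : comNzRingType) (G : A -> Prop) : A -> Prop :=
  fun q => exists gs : seq (A * A),
    (forall ag, ag \in gs -> G ag.2) /\ q = \sum_(ag <- gs) ag.1 * ag.2.

Definition homogeneous_vanishing (R : realType) (p : nat) (d : 'I_p -> nat)
  (L : finType) (theta : labeling d L) : pring R d -> Prop := fun q =>
  (exists n : nat, q \is n.-homog) /\
  (forall f : outcome d -> R, in_model theta f -> peval f q = 0).

Definition toric_ideal (R : realType) (p : nat) (d : 'I_p -> nat)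
  (L : finType) (theta : labeling d L) : pring R d -> Prop :=
  ideal_gen (homogeneous_vanishing (R := R) theta).

(* Differences of monomials; m = m' is allowed because the zero polynomial is
   among the polynomials of a CSI statement (take x = y). *)
Definition binomial_poly (R : realType) (p : nat) (d : 'I_p -> nat)
  (g : pring R d) : Prop :=
  exists m m' : 'X_{1..#|outcome d|}, g = 'X_[m] - 'X_[m'].

Definition markov_basis (R : realType) (p : nat) (d : 'I_p -> nat)
  (L : finType) (theta : labeling d L) (G : pring R d -> Prop) : Prop :=
  [/\ finite_set G,
      forall g, G g -> binomial_poly g &
      forall q, ideal_gen G q <-> toric_ideal theta q].

(* Main.v *)
(** Write weight y x for the product of the labels y along the path of an
outcome x.  A positive f with sum 1 lies in the model iff the conditional
probability of x_k given its past depends only on the stage and on x_k.  This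
property implies every stage statement, hence by soundness of the CSI axioms
every statement of J(T), and balancedness says exactly that it holds for all
positive weights.

Conversely, let c be the context of a stage of level k and C its domain.  Level
by level, for n = k + 1, ..., p, the set [n] \ C is split into parts A and B
with [k] \ C in A and k in B, such that A _||_ B | c lies in J(T) and the
polynomials satisfy t(ab) t(a'b') = t(ab') t(a'b).  Comparing coefficients of
the labels of level n in this identity shows that in the context c the stages of
that level do not depend on B, or do not depend on A.  In the first case the new
variable joins A, by absorption and contraction; the second is symmetric.  At
n = p the statement is saturated, and its binomials exchange the k-th
coordinates of two outcomes of the stage without changing the first k - 1.

Two families of outcomes of equal size with the same multiset of labels are
therefore connected by such moves: if they agree in the first k - 1 coordinates,
each stage of level k sees the same values x_k in both, and exchanges make them
agree in the k-th coordinate too.  Since distinct monomial characters are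
linearly independent, a homogeneous polynomial that vanishes on the model is a
combination of differences of monomials given by such families. *)

From mathcomp Require Import all_boot all_order all_algebra ring lra.
From mathcomp Require Import reals.
From mathcomp Require classical_sets cardinality.
Require Import Defs.

Set Implicit Arguments.
Unset Strict Implicit.
Unset Printing Implicit Defensive.

Import Order.TTheory GRing.Theory Num.Theory.
Local Open Scope ring_scope.

(** * Outcomes and partial assignments *)

Lemma disjP (T : finType) (A B : {set T}) :
  reflect (forall i, ~~ ((i \in A) && (i \in B))) [disjoint A & B].
Proof.
rewrite -setI_eq0; apply: (iffP eqP) => [/setP h i|h]; last apply/setP => i.
  by have := h i; rewrite in_setI in_set0 => ->.
by rewrite in_setI in_set0; apply/negbTE.
Qed.

Ltac cases_mem :=
  rewrite ?(in_setU, in_setI, in_setD, in_setC, in_set0, in_setT) /=;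
  repeat match goal with |- context [in_mem ?i ?A] => case: (in_mem i A) => //= end.

Ltac set_tac := apply/setP=> ?; cases_mem.

Ltac disj_tac :=
  repeat match goal with H : is_true (pairwise_disjoint _) |- _ =>
    move: H; rewrite /pairwise_disjoint /= => H end;
  repeat match goal with H : is_true (_ && _) |- _ => case/andP: H => ? ? end;
  rewrite /pairwise_disjoint /= ?andbT; repeat (apply/andP; split); try done;
  apply/disjP;
  let i := fresh "i" in move=> i;
  repeat match goal with H : is_true [disjoint _ & _] |- _ =>
    move/disjP/(_ i): H end;
  cases_mem.

Lemma exists_ord_neq n (s : 'I_n) : (1 < n)%N -> exists s', s' != s.
Proof.
move=> n_gt1; have : (0 < #|[set~ s]|)%N by rewrite cardsC1 card_ord -ltnS prednK // ltnW.
by case/card_gt0P => s'; rewrite in_setC1; exists s'.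
Qed.

Section Outcomes.
Variables (p : nat) (d : 'I_p -> nat).
Implicit Types (x y z w : outcome d) (A B C D M : {set 'I_p}) (c : passign d).

Definition agree M x y := [forall i in M, x i == y i].

Lemma agreeP M x y : reflect (forall i, i \in M -> x i = y i) (agree M x y).
Proof.
apply: (iffP forallP) => h i; first by move=> iM; have := h i; rewrite iM => /eqP.
by apply/implyP => iM; rewrite h.
Qed.

Lemma agreexx M x : agree M x x.
Proof. exact/agreeP. Qed.

Lemma agree_sym M x y : agree M x y = agree M y x.
Proof. by apply/agreeP/agreeP => h i iM; rewrite h. Qed.

Lemma agree_trans M y x z : agree M x y -> agree M y z -> agree M x z.
Proof. by move=> /agreeP hxy /agreeP hyz; apply/agreeP => i iM; rewrite hxy ?hyz. Qed.

Lemma agree_sub M M' x y : M \subset M' -> agree M' x y -> agree M x y.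
Proof. by move=> /subsetP sM /agreeP h; apply/agreeP => i /sM; apply: h. Qed.

Lemma agreeU M M' x y : agree (M :|: M') x y = agree M x y && agree M' x y.
Proof.
apply/idP/andP => [h|[/agreeP h1 /agreeP h2]].
  by split; apply: agree_sub h; rewrite ?subsetUl ?subsetUr.
by apply/agreeP => i; rewrite inE => /orP[/h1|/h2].
Qed.

Lemma agree_eql M x y z : agree M x y -> agree M x z = agree M y z.
Proof.
move=> h; apply/idP/idP => [hxz|]; last exact: agree_trans h.
by apply: agree_trans hxz; rewrite agree_sym.
Qed.

Lemma agreeT x y : agree [set: 'I_p] x y = (x == y).
Proof.
apply/agreeP/eqP => [h|-> //].
by apply/ffunP => i; apply: h.
Qed.

Lemma swapE B x y i : swap B x y i = if i \in B then y i else x i.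
Proof. by rewrite ffunE. Qed.

Lemma swapK B x y : swap B (swap B x y) (swap B y x) = x.
Proof. by apply/ffunP => i; rewrite !swapE; case: (i \in B). Qed.

Definition extends c x := restr (dom c) x == c.

Lemma extendsP c x : reflect (forall i, i \in dom c -> c i = Some (x i)) (extends c x).
Proof.
apply: (iffP eqP) => [h i iC|h].
  by rewrite -[in LHS]h ffunE iC.
apply/ffunP => i; rewrite ffunE; case: ifPn => [/h //|].
by rewrite inE negbK => /eqP.
Qed.

Lemma extends_agree c x y : extends c x -> extends c y = agree (dom c) x y.
Proof.
move/extendsP => h; apply/extendsP/agreeP => h' i iC.
  by have := h' i iC; rewrite h // => -[].
by rewrite h // h'.
Qed.

Lemma extends_swap c B x y : extends c x -> extends c y -> extends c (swap B x y).
Proof.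
move=> hx; rewrite !(extends_agree _ hx) => /agreeP h; apply/agreeP => i iC.
by rewrite swapE; case: ifP => // _; apply: h.
Qed.

Lemma prefix_eq k x y : (prefix k x == prefix k y) = agree (below p k) x y.
Proof.
rewrite -val_eqE /=; apply/eqP/agreeP => [/ffunP h i iM|h].
  by have := h i; rewrite !ffunE iM => -[].
by apply/ffunP => i; rewrite !ffunE; case: ifP => // /h ->.
Qed.

Lemma mem_below k (i : 'I_p) : (i \in below p k) = (i < k)%N.
Proof. by rewrite inE. Qed.

Lemma belowS (k : 'I_p) : below p k.+1 = k |: below p k.
Proof. by apply/setP=> i; rewrite !inE ltnS leq_eqVlt. Qed.

Lemma below_full : below p p = [set: 'I_p].
Proof. by apply/setP=> i; rewrite !inE ltn_ord. Qed.

Lemma below0 : below p 0 = set0.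
Proof. by apply/setP=> i; rewrite !inE. Qed.

(** This turns balancedness, a condition on vertices, into one on outcomes. *)
Lemma child_prefix (k : 'I_p) x y :
  child (prefix k x) (y k) = prefix k.+1 (swap [set k] x y).
Proof.
apply: val_inj; apply/ffunP => i; rewrite /= !ffunE inE ltnS.
have [->|nik] := eqVneq i k; first by rewrite dfwith_in leqnn inE eqxx.
rewrite dfwith_out 1?eq_sym // ffunE !inE (negbTE nik).
by rewrite [(i <= k)%N]leq_eqVlt (_ : (i == k :> nat) = false) //; apply/negbTE.
Qed.

(** The values of the coordinates in [D] are represented by the outcomes [w] that differ from [x]
    only there; the sum is split along the fibres of [swap D x]. *)
Lemma sum_agree (V : nmodType) D M (F : outcome d -> V) x :
  [disjoint D & M] ->
  \sum_(z | agree M x z) F z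
    = \sum_(w | agree (~: D) x w) \sum_(z | agree (M :|: D) w z) F z.
Proof.
move=> dDM; rewrite (partition_big (swap D x) (agree (~: D) x)) /=; last first.
  by move=> z _; apply/agreeP => i; rewrite swapE inE => /negbTE ->.
apply: eq_bigr => w /agreeP hxw; apply: eq_bigl => z.
apply/andP/agreeP => [[/agreeP hM /eqP <-] i|h].
  rewrite inE swapE; case: ifP => // iD; rewrite orbF; exact: hM.
split.
  apply/agreeP => i iM; rewrite hxw ?h ?inE ?iM //.
  by apply: contraL iM => iD; rewrite (disjointFr dDM).
apply/eqP/ffunP => i; rewrite swapE; case: ifPn => iD.
  by rewrite h // inE iD orbT.
by rewrite hxw // inE.
Qed.

Definition upd x (k : 'I_p) (s : 'I_(d k)) : outcome d :=
  [ffun i => dfwith (T := fun j => 'I_(d j)) x s i].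

Lemma upd_in x k (s : 'I_(d k)) : upd x s k = s.
Proof. by rewrite ffunE dfwith_in. Qed.

Lemma upd_out x k (s : 'I_(d k)) i : i != k -> upd x s i = x i.
Proof. by move=> nik; rewrite ffunE dfwith_out // eq_sym. Qed.

Lemma agree_upd x k (s : 'I_(d k)) : agree (~: [set k]) x (upd x s).
Proof. by apply/agreeP => i; rewrite !inE => nik; rewrite upd_out. Qed.

Lemma sum_upd (V : nmodType) x k (F : outcome d -> V) :
  \sum_(w | agree (~: [set k]) x w) F w = \sum_(s < d k) F (upd x s).
Proof.
rewrite (reindex_onto (fun s => upd x s) (fun w => w k)) /=; last first.
  move=> w /agreeP h; apply/ffunP => i; rewrite ffunE.
  have [->|nik] := eqVneq i k; first by rewrite dfwith_in.
  by rewrite dfwith_out 1?eq_sym // h // !inE.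
by apply: eq_bigl => s; rewrite agree_upd upd_in eqxx.
Qed.

Lemma exists_extends c : (forall i, 0 < d i)%N -> exists x, extends c x.
Proof.
move=> d_gt0.
exists [ffun i => if c i is Some s then s else Ordinal (d_gt0 i)].
by apply/extendsP => i; rewrite inE ffunE; case: (c i).
Qed.

Lemma exists_prefix k (v : level d k) :
  (forall i, 0 < d i)%N -> exists x, prefix k x = v.
Proof.
move=> /(exists_extends (val v))[x /extendsP hx]; exists x; apply: val_inj.
apply/ffunP => i; rewrite /= ffunE.
have -> : (i \in below p k) = (i \in dom (val v)) by rewrite (eqP (valP v)).
by case: ifPn => [/hx //|]; rewrite inE negbK => /eqP.
Qed.

End Outcomes.

(** * Soundness of the CSI axioms *)

Section Marginals.
Variables (R : realType) (p : nat) (d : 'I_p -> nat) (f : outcome d -> R).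
Hypothesis f_gt0 : forall x, 0 < f x.
Implicit Types (x y z w : outcome d) (A B C D M S T : {set 'I_p}) (c xT : passign d).

(** The marginal of x_M, with a full outcome standing for its restriction to [M]. *)
Definition marg M x := \sum_(z | agree M x z) f z.

Lemma marg_agree M x y : agree M x y -> marg M x = marg M y.
Proof. by move=> h; apply: eq_bigl => z; rewrite (agree_eql _ h). Qed.

Lemma marg_sum D M x : [disjoint D & M] ->
  marg M x = \sum_(w | agree (~: D) x w) marg (M :|: D) w.
Proof. exact: sum_agree. Qed.

Lemma marg_full x : marg [set: 'I_p] x = f x.
Proof. by rewrite /marg (big_pred1 x) // => z; rewrite agreeT eq_sym. Qed.

Lemma marg_gt0 M x : 0 < marg M x.
Proof.
rewrite /marg (bigD1 x) ?agreexx //=.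
by apply: ltr_wpDr => //; apply: sumr_ge0 => z _; apply: ltW.
Qed.

(* The conditional independence statement written without conditional
   probabilities: f(abs) f(s) = f(as) f(bs), in the context c. *)
Definition indep A B S c := forall x, extends c x ->
  marg (A :|: B :|: S :|: dom c) x * marg (S :|: dom c) x
    = marg (A :|: S :|: dom c) x * marg (B :|: S :|: dom c) x.

Lemma indep_sym A B S c : indep A B S c -> indep B A S c.
Proof. by move=> h x /h; rewrite [B :|: A]setUC => ->; rewrite mulrC. Qed.

Lemma indep_decomposition A B D S c :
  pairwise_disjoint [:: A; B; D; S; dom c] ->
  indep A (B :|: D) S c -> indep A B S c.
Proof.
move=> pd h x hx.
have dD : [disjoint D & A :|: B :|: S :|: dom c] by disj_tac.
have dD2 : [disjoint D & B :|: S :|: dom c] by disj_tac.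
rewrite (marg_sum _ dD) (marg_sum x dD2) [LHS]mulr_suml [RHS]mulr_sumr.
apply: eq_bigr => w xw.
have xwM M : [disjoint D & M] -> agree M x w.
  by rewrite disjoint_sym disjoints_subset => /agree_sub; apply.
rewrite (@marg_agree (S :|: dom c) x w); last by apply: xwM; disj_tac.
rewrite (@marg_agree (A :|: S :|: dom c) x w); last by apply: xwM; disj_tac.
have -> : A :|: B :|: S :|: dom c :|: D = A :|: (B :|: D) :|: S :|: dom c.
  by set_tac.
have -> : B :|: S :|: dom c :|: D = B :|: D :|: S :|: dom c by set_tac.
by apply: h; rewrite (extends_agree _ hx); apply: xwM; disj_tac.
Qed.

(** Decomposition also yields independence of [A] and [D] given [S]; the two identities combine
    after cancelling a positive marginal. *)
Lemma indep_weak_union A B D S c :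
  pairwise_disjoint [:: A; B; D; S; dom c] ->
  indep A (B :|: D) S c -> indep A B (S :|: D) c.
Proof.
move=> pd h x hx; have h1 := h x hx.
have h2 : indep A D S c.
  apply: (@indep_decomposition A D B); first by disj_tac.
  by rewrite setUC.
have {}h2 := h2 x hx.
have -> : A :|: B :|: (S :|: D) :|: dom c = A :|: (B :|: D) :|: S :|: dom c.
  by set_tac.
have -> : A :|: (S :|: D) :|: dom c = A :|: D :|: S :|: dom c by set_tac.
have -> : B :|: (S :|: D) :|: dom c = B :|: D :|: S :|: dom c by set_tac.
have -> : S :|: D :|: dom c = D :|: S :|: dom c by set_tac.
apply: (mulIf (lt0r_neq0 (marg_gt0 (S :|: dom c) x))).
rewrite mulrAC h1 [RHS]mulrAC h2; ring.
Qed.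

Lemma indep_contraction A B D S c :
  indep A B (S :|: D) c -> indep A D S c ->
  indep A (B :|: D) S c.
Proof.
move=> h1 h2 x hx; have {}h1 := h1 x hx; have {}h2 := h2 x hx; move: h1 h2.
have -> : A :|: B :|: (S :|: D) :|: dom c = A :|: (B :|: D) :|: S :|: dom c.
  by set_tac.
have -> : A :|: (S :|: D) :|: dom c = A :|: D :|: S :|: dom c by set_tac.
have -> : B :|: (S :|: D) :|: dom c = B :|: D :|: S :|: dom c by set_tac.
have -> : S :|: D :|: dom c = D :|: S :|: dom c by set_tac.
move=> h1 h2; apply: (mulIf (lt0r_neq0 (marg_gt0 (D :|: S :|: dom c) x))).
rewrite mulrAC h1 mulrAC h2; ring.
Qed.

(** By the two hypotheses the conditional probability of [A] given the rest changes neither with [B]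
    nor with [S]. The claim [step] treats simultaneous changes of both; it is then summed over their
    values. *)
Lemma indep_intersection A B D S c :
  pairwise_disjoint [:: A; B; D; S; dom c] ->
  indep A B (S :|: D) c -> indep A S (B :|: D) c ->
  indep A (B :|: S) D c.
Proof.
move=> pd h1 h2.
pose C := dom c.
have step x y : extends c x -> agree (~: (B :|: S)) x y ->
    marg (A :|: (B :|: S) :|: D :|: C) x * marg (B :|: S :|: D :|: C) y =
    marg (A :|: (B :|: S) :|: D :|: C) y * marg (B :|: S :|: D :|: C) x.
  move=> hx xy.
  have xyM M : [disjoint B :|: S & M] -> agree M x y.
    by rewrite disjoint_sym disjoints_subset => /agree_sub; apply.
  have hy : extends c y.
    by rewrite (extends_agree _ hx); apply: xyM; disj_tac.
  (* [z] leads from [x] to [y] by changing first the coordinates in [B], then those in [S]. *)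
  pose z := swap B x y.
  have xz M : [disjoint B & M] -> agree M x z.
    move=> dB; apply/agreeP => i iM; rewrite swapE.
    by rewrite (disjointFl dB).
  have zy M : [disjoint S & M] -> agree M z y.
    move=> dS; apply/agreeP => i iM; rewrite swapE.
    case: ifPn => // iB; apply: (agreeP _ _ _ xy); rewrite in_setC in_setU.
    by rewrite (negbTE iB) (disjointFl dS).
  have hz : extends c z.
    by rewrite (extends_agree _ hx); apply: xz; disj_tac.
  move: (h1 x hx) (h1 z hz) (h2 z hz) (h2 y hy).
  rewrite -/C.
  have -> : A :|: B :|: (S :|: D) :|: C = A :|: (B :|: S) :|: D :|: C by set_tac.
  have -> : A :|: S :|: (B :|: D) :|: C = A :|: (B :|: S) :|: D :|: C by set_tac.
  have -> : B :|: (S :|: D) :|: C = B :|: S :|: D :|: C by set_tac.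
  have -> : S :|: (B :|: D) :|: C = B :|: S :|: D :|: C by set_tac.
  have e1 : marg (S :|: D :|: C) z = marg (S :|: D :|: C) x.
    by apply/esym/marg_agree/xz; disj_tac.
  have e2 : marg (A :|: (S :|: D) :|: C) z = marg (A :|: (S :|: D) :|: C) x.
    by apply/esym/marg_agree/xz; disj_tac.
  have e3 : marg (B :|: D :|: C) z = marg (B :|: D :|: C) y.
    by apply/marg_agree/zy; disj_tac.
  have e4 : marg (A :|: (B :|: D) :|: C) z = marg (A :|: (B :|: D) :|: C) y.
    by apply/marg_agree/zy; disj_tac.
  rewrite e1 e2 e3 e4.
  have := lt0r_neq0 (marg_gt0 (S :|: D :|: C) x).
  have := lt0r_neq0 (marg_gt0 (B :|: D :|: C) y).
  have := lt0r_neq0 (marg_gt0 (B :|: S :|: D :|: C) z).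
  move: (marg _ _) (marg _ _) (marg _ _) (marg _ _) (marg _ _) (marg _ _)
    (marg _ _) (marg _ _) (marg _ _) (marg _ _) => u1 u2 u3 u4 u5 u6 u7 u8 u9 u10.
  move=> n10 n9 n8 a1 a2 a3 a4.
  apply: (mulIf n8); apply: (mulIf n9); apply: (mulIf n10).
  have -> : u7 * u1 * u8 * u9 * u10 = u7 * u8 * (u1 * u9 * u10) by ring.
  have -> : u2 * u5 * u8 * u9 * u10 = u2 * u9 * (u5 * u8 * u10) by ring.
  rewrite a1 a4.
  have -> : u6 * u5 * (u1 * u9 * u10) = u6 * u10 * (u5 * u1 * u9) by ring.
  have -> : u3 * u1 * (u5 * u8 * u10) = u3 * u10 * (u1 * u5 * u8) by ring.
  rewrite -a2 -a3; ring.
move=> x hx.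
have dBS : [disjoint B :|: S & A :|: D :|: C] by disj_tac.
have dBS2 : [disjoint B :|: S & D :|: C] by disj_tac.
rewrite (marg_sum x dBS) (marg_sum x dBS2) [LHS]mulr_sumr [RHS]mulr_suml.
apply: eq_bigr => w xw.
have -> : A :|: D :|: C :|: (B :|: S) = A :|: (B :|: S) :|: D :|: C by set_tac.
have -> : D :|: C :|: (B :|: S) = B :|: S :|: D :|: C by set_tac.
exact: step.
Qed.

(** Moving [T] from the conditioning set into the context leaves every union in the identity
    unchanged; absorption moves it back. *)
Lemma indep_specialization A B S T c xT :
  T \subset S -> xT \in Rset d T -> pairwise_disjoint [:: A; B; S; dom c] ->
  indep A B S c -> indep A B (S :\: T) (glue xT c).
Proof.
rewrite inE => sTS /eqP dxT pd h x hx.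
have dT : dom (glue xT c) = T :|: dom c.
  by apply/setP => i; rewrite -dxT !inE ffunE; case: (xT i).
have hxc : extends c x.
  apply/extendsP => i ic; have := extendsP _ _ hx i.
  rewrite dT inE ic orbT ffunE => /(_ isT).
  have : i \notin dom xT.
    rewrite dxT; apply/negP => /(subsetP sTS) iS.
    move: pd; rewrite /pairwise_disjoint /= => /and3P[_ _].
    by case/andP=> /andP[/disjP/(_ i)]; rewrite iS ic.
  by rewrite inE negbK => /eqP ->.
move: (h x hxc); rewrite dT.
have eU M : M :|: (S :\: T) :|: (T :|: dom c) = M :|: S :|: dom c.
  apply/setP => i; have := subsetP sTS i; rewrite !(in_setU, in_setD).
  case: (i \in T) => [/(_ isT) ->|_] /=; cases_mem.
have eU0 : S :\: T :|: (T :|: dom c) = S :|: dom c by have := eU set0; rewrite !set0U.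
by rewrite !eU eU0.
Qed.

Lemma indep_absorption A B S T c :
  (forall xT : passign d, xT \in Rset d T -> indep A B S (glue c xT)) ->
  indep A B (S :|: T) c.
Proof.
move=> h x hx.
have dT : dom (glue c (restr T x)) = dom c :|: T.
  apply/setP => i; rewrite !inE !ffunE; case: (c i) => //=.
  by case: (i \in T).
have rT : restr T x \in Rset d T by rewrite inE dom_restr.
have hxT : extends (glue c (restr T x)) x.
  apply/extendsP => i; rewrite dT inE !ffunE.
  have := extendsP _ _ hx i; rewrite inE.
  by case: (c i) => [s ->|_ /= ->].
move: (h _ rT x hxT); rewrite dT.
have eU M : M :|: (S :|: T) :|: dom c = M :|: S :|: (dom c :|: T) by set_tac.
have eU0 : S :|: T :|: dom c = S :|: (dom c :|: T) by set_tac.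
by rewrite !eU eU0.
Qed.

(** Saturation turns the largest marginals into values of [f]. The right-hand sides of the
    identities at [x] and [y] have the same product as those at the two swaps, since swapping
    exchanges the marginals with [B] and keeps those with [A]. *)
Lemma indep_cross A B S c : pairwise_disjoint [:: A; B; S; dom c] ->
  saturated (CSI A B S c) -> indep A B S c ->
  forall x y, extends c x -> extends c y -> agree S x y ->
  f x * f y = f (swap B x y) * f (swap B y x).
Proof.
rewrite /saturated /= => pd sat h x y hx hy xy.
have dAB : [disjoint A & B] by disj_tac.
have xyC : agree (dom c) x y by rewrite -(extends_agree _ hx).
have hx' := extends_swap B hx hy; have hy' := extends_swap B hy hx.
move: (h x hx) (h y hy) (h _ hx') (h _ hy').
rewrite sat !marg_full.
have sw1 (u v : outcome d) : agree S u v -> agree (dom c) u v ->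
    agree (A :|: S :|: dom c) (swap B u v) u.
  move=> uvS uvC; rewrite !agreeU; apply/andP; split; first (apply/andP; split).
  - by apply/agreeP => i iA; rewrite swapE (disjointFr dAB iA).
  - by apply/agreeP => i iS; rewrite swapE; case: ifP => // _; rewrite (agreeP _ _ _ uvS).
  - by apply/agreeP => i iS; rewrite swapE; case: ifP => // _; rewrite (agreeP _ _ _ uvC).
have sw2 (u v : outcome d) : agree S u v -> agree (dom c) u v ->
    agree (B :|: S :|: dom c) (swap B u v) v.
  move=> uvS uvC; rewrite !agreeU; apply/andP; split; first (apply/andP; split).
  - by apply/agreeP => i iB; rewrite swapE iB.
  - by apply/agreeP => i iS; rewrite swapE; case: ifP => // _; rewrite (agreeP _ _ _ uvS).
  - by apply/agreeP => i iS; rewrite swapE; case: ifP => // _; rewrite (agreeP _ _ _ uvC).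
have yx : agree S y x by rewrite agree_sym.
have yxC : agree (dom c) y x by rewrite agree_sym.
rewrite !(marg_agree (sw1 _ _ _ _)) // !(marg_agree (sw2 _ _ _ _)) //.
have sw0 (u v : outcome d) : agree S u v -> agree (dom c) u v ->
    agree (S :|: dom c) (swap B u v) u.
  by move=> uvS uvC; have := sw1 u v uvS uvC; rewrite !agreeU -andbA => /andP[].
rewrite !(marg_agree (sw0 _ _ _ _)) //.
have nx := lt0r_neq0 (marg_gt0 (S :|: dom c) x).
have ny := lt0r_neq0 (marg_gt0 (S :|: dom c) y).
move=> e1 e2 e3 e4; apply: (mulIf nx); apply: (mulIf ny).
have -> : forall a b m n : R, a * b * m * n = (a * m) * (b * n) by move=> *; ring.
rewrite e1 e2.
have -> : forall a b m n : R, a * b * m * n = (a * m) * (b * n) by move=> *; ring.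
rewrite e3 e4; ring.
Qed.

End Marginals.

(** * Stages *)

Section Tree.
Variables (p : nat) (d : 'I_p -> nat) (L : finType) (theta : labeling d L).
Implicit Types (x y z w : outcome d) (A B C D M S T : {set 'I_p}) (c : passign d)
  (k j : 'I_p).

(** Vertices are represented by outcomes passing through them, which avoids the dependent types of
    levels. *)
Definition same_stage k x y :=
  labels theta (prefix k x) == labels theta (prefix k y).

Lemma same_stage_sym k x y : same_stage k x y = same_stage k y x.
Proof. by rewrite /same_stage eq_sym. Qed.

Lemma same_stage_refl k x : same_stage k x x.
Proof. exact: eqxx. Qed.

Lemma same_stage_trans k : transitive (same_stage k).
Proof. by rewrite /same_stage => y x z /eqP ->. Qed.

Lemma same_stage_agree k x y : agree (below p k) x y -> same_stage k x y.
Proof. by rewrite -prefix_eq /same_stage => /eqP ->. Qed.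

Lemma path_label_agree k x y :
  agree (below p k.+1) x y -> path_label theta x k = path_label theta y k.
Proof.
rewrite belowS agreeU => /andP[/agreeP/(_ k) + xy].
by rewrite /path_label inE eqxx => ->//; move: xy; rewrite -prefix_eq => /eqP ->.
Qed.

Lemma mem_labels k x : path_label theta x k \in labels theta (prefix k x).
Proof. by apply/imsetP; exists (x k). Qed.

(** Supplies the disjointness needed by [indep_cross]; each axiom only regroups disjoint sets. *)
Lemma pairwise_disjoint_JT s : JT theta s ->
  pairwise_disjoint [:: csi_left s; csi_right s; csi_cond s; dom (csi_ctx s)].
Proof.
elim => {s} /=.
- move=> k v; set c := stage_context _ _.
  have kF : k \notin below p k by rewrite mem_below ltnn.
  have kC : k \notin dom c.
    rewrite inE ffunE negbK; case: ifP => // _.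
    have : k \notin dom (val v) by rewrite (eqP (valP v)).
    by rewrite inE negbK.
  move: (dom c) kC (below p k) kF => C kC E kE.
  have d1 : [disjoint [set k] & C] by rewrite disjoints1.
  have d2 : [disjoint [set k] & E] by rewrite disjoints1.
  by disj_tac.
- by move=> A B S c pd _ _; disj_tac.
- by move=> A B D S c pd _ _; disj_tac.
- by move=> A B D S c pd _ _; disj_tac.
- by move=> A B D S c pd _ _ _ _; disj_tac.
- by move=> A B D S c pd _ _ _ _; disj_tac.
- move=> A B S T c xT _ sTS + _ pd; rewrite inE => /eqP dxT.
  have -> : dom (glue xT c) = T :|: dom c.
    by apply/setP => i; rewrite -dxT !inE ffunE; case: (xT i).
  have sT M : [disjoint M & S] -> [disjoint M & T].
    by move=> dMS; apply: disjointWr dMS.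
  have d1 : [disjoint A & T] by apply: sT; disj_tac.
  have d2 : [disjoint B & T] by apply: sT; disj_tac.
  by disj_tac.
- by move=> A B S T c pd _ _; disj_tac.
Qed.

Hypotheses (d_ge2 : forall i, (2 <= d i)%N) (hT : CStree theta).

Lemma d_gt0 i : (0 < d i)%N.
Proof. exact: leq_trans (d_ge2 i). Qed.

(** Label sets are equal or disjoint, and equality is excluded across levels. *)
Lemma path_label_level k j x y :
  path_label theta x k = path_label theta y j -> k = j.
Proof.
case: hT => -[_ dj] hlev _ _ e; apply/eqP; apply: contraT => nkj.
case: (dj k j (prefix k x) (prefix j y)) => [/(hlev _ _ _ _ nkj) //|].
by move/disjP/(_ (path_label theta x k)); rewrite mem_labels e mem_labels.
Qed.

Lemma path_label_same_stage k x y :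
  path_label theta x k = path_label theta y k -> same_stage k x y.
Proof.
case: hT => -[_ dj] _ _ _ e.
case: (dj k k (prefix k x) (prefix k y)) => [/eqP //|].
by move/disjP/(_ (path_label theta x k)); rewrite mem_labels e mem_labels.
Qed.

Lemma same_stage_path_label k x y :
  same_stage k x y -> x k = y k -> path_label theta x k = path_label theta y k.
Proof. by case: hT => _ _ h _ /eqP /h e xy; rewrite /path_label e xy. Qed.

(** A vertex has as many labels as edges, so they are distinct; within a stage they belong to the
    same values. *)
Lemma path_label_value k x y :
  path_label theta x k = path_label theta y k -> x k = y k.
Proof.
move=> e; have /eqP st := path_label_same_stage e.
case: hT => -[cardl _] _ hlab _.
have /imset_injP inj : #|labels theta (prefix k x)| == #|'I_(d k)|.
  by rewrite cardl card_ord.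
by apply: (inj (x k) (y k)) => //; rewrite (hlab _ _ _ (y k) st).
Qed.

Lemma dom_stage_context k x : dom (stage_context theta (prefix k x)) \subset below p k.
Proof.
apply/subsetP => i; rewrite !inE ffunE; case: ifP => // _.
by rewrite ffunE inE; case: (i < k)%N.
Qed.

(** A CStree stage consists of all extensions of some [c]. Its elements agree on [dom c], so
    extending the stage context forces membership; the converse is the definition of the context. *)
Lemma extends_stage_context k x y :
  extends (stage_context theta (prefix k x)) y = same_stage k x y.
Proof.
apply/extendsP/idP => [h|st i].
  case: hT => _ _ _ /(_ k (prefix k x))[C [c [sC cC /setP hS]]].
  have dc : dom c = C by move: cC; rewrite inE => /eqP.
  have memS z : same_stage k x z = (val (prefix k z) \in
      [set glue c u | u in Rset d (below p k :\: C)]).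
    rewrite -hS mem_imset ?inE; last exact: val_inj.
    by rewrite eq_sym.
  have ctxC z i : same_stage k x z -> i \in C -> c i = Some (z i).
    rewrite memS => /imsetP[u _ /ffunP/(_ i)] + iC.
    rewrite /= !ffunE (subsetP sC _ iC); move: iC; rewrite -dc inE.
    by case: (c i) => // s _ [<-].
  rewrite memS; apply/imsetP; exists (restr (below p k :\: C) y).
    by rewrite inE dom_restr.
  apply/ffunP => i; rewrite /= !ffunE in_setD; case: (boolP (i \in C)) => iC /=.
    have xi := ctxC x i (eqxx _) iC.
    rewrite xi (subsetP sC _ iC); have := h i; rewrite inE ffunE.
    case: ifPn => [_|/forallP[]]; last first.
      move=> z; apply/implyP; rewrite inE => stz.
      have [x' ex'] := exists_prefix z d_gt0.
      move: stz; rewrite -ex' eq_sym => /(ctxC x' i)/(_ iC) ex''.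
      by rewrite /= !ffunE (subsetP sC _ iC) -ex'' xi.
    by rewrite /= ffunE (subsetP sC _ iC) => /(_ isT)[->].
  by move: iC; rewrite -dc inE negbK => /eqP ->.
rewrite inE ffunE; case: ifPn => // /forallP/(_ (prefix k y)).
rewrite inE eq_sym -/(same_stage k x y) st /= => /eqP <-.
by rewrite ffunE; case: ifP.
Qed.

End Tree.

(** * Stage-invariant distributions *)

Section Model.
Variables (R : realType) (p : nat) (d : 'I_p -> nat) (L : finType)
  (theta : labeling d L).
Hypotheses (d_ge2 : forall i, (2 <= d i)%N) (hT : CStree theta).
Implicit Types (f : outcome d -> R) (y : L -> R) (x z w : outcome d)
  (k j : 'I_p).

(* The conditional probability of x_k given x_1, ..., x_{k-1} depends only on
   x_k and on the stage, written without quotients. *)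
Definition stage_invariant f := forall k x x',
  same_stage theta k x x' -> x k = x' k ->
  marg f (below p k.+1) x * marg f (below p k) x'
    = marg f (below p k.+1) x' * marg f (below p k) x.

Lemma disjoint1_below k : [disjoint [set k] & below p k].
Proof. by rewrite disjoints1 mem_below ltnn. Qed.

Lemma marg_below_rec f k x :
  marg f (below p k) x = \sum_(s < d k) marg f (below p k.+1) (upd x s).
Proof.
by rewrite (marg_sum f x (disjoint1_below k)) sum_upd belowS setUC.
Qed.

Lemma agree_below_upd k (s : 'I_(d k)) x : agree (below p k) x (upd x s).
Proof.
apply: agree_sub (agree_upd x s); apply/subsetP => i.
rewrite mem_below in_setC in_set1 => ik.
by apply: contraTneq ik => ->; rewrite ltnn.
Qed.

Lemma JT_indep f (s : csi d) : (forall x, 0 < f x) -> stage_invariant f ->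
  JT theta s -> indep f (csi_left s) (csi_right s) (csi_cond s) (csi_ctx s).
Proof.
move=> f_gt0 inv; elim => {s} /=.
- move=> k v; have [x0 <-] := exists_prefix v (d_gt0 d_ge2).
  set c := stage_context _ _ => x hx.
  have sC : dom c \subset below p k := dom_stage_context theta k x0.
  pose F := below p k :\: dom c.
  have eF : dom c :|: F = below p k.
    by rewrite /F setDE setUIr setUCr setIT (setUidPr sC).
  have dF : [disjoint F & dom c].
    by apply/disjP => i; rewrite /F; cases_mem.
  have kF : k \notin F by rewrite in_setD mem_below ltnn andbF.
  have dF' : [disjoint F & k |: dom c].
    apply/disjP => i; rewrite in_setU1 andb_orr negb_or (disjP _ _ dF) andbT.
    by case: eqVneq => [->|]; rewrite ?(negbTE kF) ?andbF.
  rewrite -/F !setU0 set0U -setUA [F :|: _]setUC eF -belowS.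
  (* The two marginals without [F] are summed over the values [w] of [F]; such [w] stay in the
     stage, so the summands match by invariance. *)
  rewrite (marg_sum f x dF) (marg_sum f x dF') [LHS]mulr_sumr [RHS]mulr_suml.
  apply: eq_bigr => w xw; rewrite -setUA eF -belowS.
  have hw : extends c w.
    rewrite (extends_agree _ hx); apply: agree_sub xw.
    by rewrite -disjoints_subset disjoint_sym.
  apply: inv.
    apply: (@same_stage_trans _ _ _ _ _ x0); last first.
      by rewrite -extends_stage_context.
    by rewrite same_stage_sym -extends_stage_context.
  by apply: (agreeP _ _ _ xw); rewrite in_setC.
- by move=> A B S c _ _; apply: indep_sym.
- by move=> A B D S c pd _; apply: indep_decomposition.
- by move=> A B D S c pd _; apply: indep_weak_union.
- by move=> A B D S c _ _ + _; apply: indep_contraction.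
- by move=> A B D S c pd _ + _; apply: indep_intersection.
- by move=> A B S T c xT pd sT hxT _; apply: indep_specialization.
- by move=> A B S T c _ _; apply: indep_absorption.
Qed.

Definition weight y x := \prod_k y (path_label theta x k).

(* The value at y of the polynomial t of the prefix of x of length n. *)
Definition tail y n x := \sum_(z | agree (below p n) x z)
  \prod_(j < p | (n <= j)%N) y (path_label theta z j).

Lemma tail_tpoly y n x :
  (tpoly R theta (prefix n x)).@[fun i => y (enum_val i)] = tail y n x.
Proof.
rewrite /tpoly rmorph_sum /=; apply: eq_big => z; first by rewrite eq_sym prefix_eq.
move=> _; rewrite rmorph_prod; apply: eq_bigr => j _ /=.
by rewrite mevalXU enum_rankK.
Qed.

Lemma tail_agree y n x x' : agree (below p n) x x' -> tail y n x = tail y n x'.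
Proof. by move=> h; apply: eq_bigl => z; rewrite (agree_eql _ h). Qed.

Lemma tail_full y x : tail y p x = 1.
Proof.
rewrite /tail below_full (big_pred1 x); last by move=> z; rewrite agreeT eq_sym.
by rewrite big1 // => j; rewrite leqNgt ltn_ord.
Qed.

Lemma tail_rec y k x : tail y k x =
  \sum_(s < d k) y (path_label theta (upd x s) k) * tail y k.+1 (upd x s).
Proof.
rewrite /tail (sum_agree _ _ (disjoint1_below k)) sum_upd.
apply: eq_bigr => s _; rewrite setUC -belowS big_distrr; apply: eq_bigr => z /= h.
rewrite (bigD1 k) //= (path_label_agree theta h); congr (_ * _).
by apply: eq_bigl => j; rewrite andbC ltn_neqAle eq_sym.
Qed.

Lemma prod_below_rec (F : 'I_p -> R) k :
  \prod_(j < p | (j < k.+1)%N) F j = F k * \prod_(j : 'I_p | (j < k)%N) F j.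
Proof.
rewrite (bigD1 k) //=; congr (_ * _); apply: eq_bigl => j.
by rewrite andbC ltnS [RHS]ltn_neqAle.
Qed.

Lemma prod_path_label_agree y n x x' : agree (below p n) x x' ->
  \prod_(j < p | (j < n)%N) y (path_label theta x j)
    = \prod_(j < p | (j < n)%N) y (path_label theta x' j).
Proof.
move=> xx'; apply: eq_bigr => j jn; congr y; apply: path_label_agree.
apply: agree_sub xx'; apply/subsetP => i; rewrite !mem_below ltnS => /leq_ltn_trans.
exact.
Qed.

(** The first [n] labels are common to all outcomes with the prefix of [x] and factor out. *)
Lemma marg_weight y n x : marg (weight y) (below p n) x =
  \prod_(j < p | (j < n)%N) y (path_label theta x j) * tail y n x.
Proof.
rewrite /tail big_distrr; apply: eq_bigr => z xz /=.
rewrite (prod_path_label_agree y xz) /weight (bigID (fun j : 'I_p => (j < n)%N)) /=.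
by congr (_ * _); apply: eq_bigl => j; rewrite -leqNgt.
Qed.

Lemma tail_gt0 y n x : (forall l, 0 < y l) -> 0 < tail y n x.
Proof.
move=> y_gt0; rewrite /tail (bigD1 x) ?agreexx //= ltr_wpDr //.
  by apply: sumr_ge0 => z _; apply/ltW/prodr_gt0.
exact: prodr_gt0.
Qed.

Lemma weight_gt0 y x : (forall l, 0 < y l) -> 0 < weight y x.
Proof. by move=> y_gt0; apply: prodr_gt0. Qed.

Lemma eq_tail y y' n x :
  (forall z j, (n <= j)%N -> y (path_label theta z j) = y' (path_label theta z j)) ->
  tail y n x = tail y' n x.
Proof. by move=> h; apply: eq_bigr => z _; apply: eq_bigr => j /h. Qed.

Lemma balanced_tail y k x x' : balanced R theta -> same_stage theta k x x' ->
  tail y k.+1 x * tail y k.+1 x'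
    = tail y k.+1 (swap [set k] x x') * tail y k.+1 (swap [set k] x' x).
Proof.
move=> bal /eqP /(bal k _ _ (x k) (x' k)) /(congr1 (meval (fun i => y (enum_val i)))).
rewrite !rmorphM /= !child_prefix !tail_tpoly => e.
have swxx z : swap [set k] z z = z by apply/ffunP => i; rewrite swapE if_same.
by rewrite !swxx in e.
Qed.

(** Marginals of the first coordinates are expanded over the value [s] of the [k]-th one; the
    hypothesis for [x] and [upd x' s] matches the summands. *)
Lemma marg_invariant f :
  (forall k x x', same_stage theta k x x' ->
     marg f (below p k.+1) x * marg f (below p k.+1) x'
       = marg f (below p k.+1) (swap [set k] x x')
         * marg f (below p k.+1) (swap [set k] x' x)) ->
  stage_invariant f.
Proof.
move=> h k x x' st xk.
rewrite !marg_below_rec [LHS]mulr_sumr [RHS]mulr_sumr; apply: eq_bigr => s _.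
rewrite h; last by apply: same_stage_trans st _; apply/same_stage_agree/agree_below_upd.
rewrite [LHS]mulrC; congr (_ * _); congr (marg _ _ _).
  apply/ffunP => i; rewrite swapE in_set1.
  by case: eqVneq => [->|/upd_out ->].
apply/ffunP => i; rewrite swapE in_set1.
by case: eqVneq => [->|/upd_out -> //]; rewrite !upd_in.
Qed.

(** Within a stage, swapping the [k]-th coordinates exchanges the labels of level [k]; balancedness
    handles the tails. *)
Lemma weight_invariant y : balanced R theta -> stage_invariant (weight y).
Proof.
move=> bal; apply: marg_invariant => k x x' st.
have ag (u v : outcome d) : agree (below p k) u (swap [set k] u v).
  apply/agreeP => i; rewrite swapE in_set1 mem_below; case: eqVneq => // ->.
  by rewrite ltnn.
have lab (u v : outcome d) : same_stage theta k u v ->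
    path_label theta (swap [set k] u v) k = path_label theta v k.
  move=> uv; apply: (same_stage_path_label hT); last by rewrite swapE set11.
  by apply: same_stage_trans uv; rewrite same_stage_sym same_stage_agree.
rewrite !marg_weight !prod_below_rec !lab //; last by rewrite same_stage_sym.
rewrite -!(prod_path_label_agree _ (ag _ _)).
rewrite mulrACA (balanced_tail y bal st) [RHS]mulrACA; congr (_ * _).
ring.
Qed.

(** Normalization at each vertex makes all tails 1, by induction from the leaves. Positivity is
    claimed only for labels on edges, since the others are unconstrained. *)
Lemma in_model_weight f : in_model theta f ->
  exists y, [/\ forall x, f x = weight y x,
    forall x k, 0 < y (path_label theta x k) & forall n x, (n <= p)%N -> tail y n x = 1].
Proof.
case=> y [y01 y1 fE]; exists y; split => //.
  by move=> x k; case/andP: (y01 k (prefix k x) (x k)).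
move=> n x np; move: {np}(subnK np); move: (p - n)%N => m.
elim: m n x => [|m IHm] n x; first by rewrite add0n => ->; rewrite tail_full.
rewrite addSnnS => e.
have np : (n < p)%N by rewrite -e leq_addl.
rewrite -[n in LHS]/(nat_of_ord (Ordinal np)) tail_rec -[RHS](y1 (Ordinal np) (prefix n x)).
apply: eq_bigr => s _; rewrite IHm // mulr1 /path_label upd_in.
have /eqP -> : prefix n (upd x s) == prefix n x.
  by rewrite eq_sym prefix_eq; apply: (agree_below_upd s).
by [].
Qed.

Lemma in_model_gt0 f x : in_model theta f -> 0 < f x.
Proof. by case/in_model_weight => y [-> h _]; apply: prodr_gt0. Qed.

Lemma eq_marg f g M : f =1 g -> marg f M =1 marg g M.
Proof. by move=> fg x; apply: eq_bigr => z _; apply: fg. Qed.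

Lemma in_model_invariant f : in_model theta f -> stage_invariant f.
Proof.
case/in_model_weight => y [fE y_gt0 y1] k x x' st xk.
rewrite !(eq_marg _ fE) !marg_weight !prod_below_rec !y1 // 1?ltnW //.
rewrite (same_stage_path_label hT st xk); ring.
Qed.

(** The parameter of a label is the conditional probability of the coordinate given its past.
    Invariance makes it depend on the label alone, and the product along a path telescopes. *)
Lemma invariant_in_model f : open_simplex f -> stage_invariant f ->
  in_model theta f.
Proof.
case=> f_gt0 f1 inv.
pose q k x := marg f (below p k.+1) x / marg f (below p k) x.
have m0 n x : marg f (below p n) x != 0 by apply/lt0r_neq0/marg_gt0.
have q_label k x j x' : path_label theta x k = path_label theta x' j -> q k x = q j x'.
  move=> e; have ekj := path_label_level hT e; move: ekj e => <- e.
  apply/eqP; rewrite eqr_div //; apply/eqP; apply: inv.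
    exact: (path_label_same_stage hT).
  exact: (path_label_value hT).
(* Labels that occur on no edge get the value 0. *)
pose y l := if [pick u : outcome d * 'I_p | path_label theta u.1 u.2 == l] is Some u
            then q u.2 u.1 else 0.
have yE k x : y (path_label theta x k) = q k x.
  rewrite /y; case: pickP => [u /eqP /q_label //|/(_ (x, k))].
  by rewrite eqxx.
have thetaE k x (s : 'I_(d k)) : @theta k (prefix k x) s = path_label theta (upd x s) k.
  rewrite /path_label upd_in; congr theta; apply/eqP; rewrite prefix_eq.
  exact: agree_below_upd.
have sum1 k x : \sum_(s < d k) y (@theta k (prefix k x) s) = 1.
  under eq_bigr => s _ do rewrite thetaE yE /q -(marg_agree f (agree_below_upd s x)).
  by rewrite -big_distrl /= -marg_below_rec divff.
have y_gt0 k x (s : 'I_(d k)) : 0 < y (@theta k (prefix k x) s).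
  by rewrite thetaE yE divr_gt0 ?marg_gt0.
exists y; split=> [k v s|k v|x].
- have [x <-] := exists_prefix v (d_gt0 d_ge2); rewrite y_gt0 /=.
  rewrite -(sum1 k x) (bigD1 s) //= ltrDl.
  (* A second child takes positive mass, so the parameter is strictly below 1. *)
  have [s' s's] := exists_ord_neq s (d_ge2 k).
  rewrite (bigD1 s') //= ltr_wpDr ?y_gt0 //.
  by apply: sumr_ge0 => r _; apply/ltW/y_gt0.
- by have [x <-] := exists_prefix v (d_gt0 d_ge2); apply: sum1.
- have prodE n : (n <= p)%N ->
      \prod_(j < p | (j < n)%N) y (path_label theta x j) = marg f (below p n) x.
    elim: n => [_|n IHn np].
      rewrite big_pred0 // below0 /marg -f1; apply: eq_bigl => z.
      by apply/esym/agreeP => i; rewrite inE.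
    rewrite (prod_below_rec _ (Ordinal np)) /= IHn 1?ltnW // yE /q /=.
    by rewrite divfK.
  rewrite -[LHS](marg_full f) -below_full -prodE //.
  by apply: eq_bigl => j; rewrite ltn_ord.
Qed.

Lemma invariant_scale f a : stage_invariant f -> stage_invariant (fun x => a * f x).
Proof.
move=> inv k x x' st xk; rewrite /marg -!big_distrr /= -!/(marg _ _ _).
by rewrite mulrACA inv // mulrACA.
Qed.

End Model.

(** * Separations of the variables in the context of a stage *)

Section Separation.
Variables (R : realType) (p : nat) (d : 'I_p -> nat) (L : finType)
  (theta : labeling d L).
Hypotheses (d_ge2 : forall i, (2 <= d i)%N) (hT : CStree theta).
Implicit Types (y : L -> R) (x z w u : outcome d) (A B C : {set 'I_p})
  (c : passign d) (k j : 'I_p).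

Local Notation tail := (tail theta).
Local Notation path_label := (path_label theta).
Local Notation same_stage := (same_stage theta).

Lemma upd_id x j : upd x (x j) = x.
Proof.
apply/ffunP => i; have [->|nij] := eqVneq i j; first by rewrite upd_in.
by rewrite upd_out.
Qed.

Lemma swap1 j x x' : swap [set j] x x' = upd x (x' j).
Proof.
apply/ffunP => i; rewrite swapE in_set1; case: eqVneq => [->|nij].
  by rewrite upd_in.
by rewrite upd_out.
Qed.

Lemma swap_updr B j x x' (s : 'I_(d j)) : j \notin B ->
  swap B x (upd x' s) = swap B x x'.
Proof.
move=> jB; apply/ffunP => i; rewrite !swapE; case: ifPn => // iB.
by rewrite upd_out //; apply: contraNneq jB => <-.
Qed.

Lemma swap_updl B j x x' (s : 'I_(d j)) : j \notin B ->
  swap B (upd x s) x' = upd (swap B x x') s.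
Proof.
move=> jB; apply/ffunP => i; have [->|nij] := eqVneq i j.
  by rewrite swapE (negbTE jB) !upd_in.
by rewrite (upd_out _ _ nij) !swapE (upd_out _ _ nij).
Qed.

Lemma same_stage_upd j x (s : 'I_(d j)) : same_stage j x (upd x s).
Proof. exact/same_stage_agree/agree_below_upd. Qed.

Lemma path_label_upd j x w (s : 'I_(d j)) :
  (path_label (upd w s) j == path_label x j) = same_stage j w x && (s == x j).
Proof.
apply/eqP/andP => [e|[st /eqP sx]].
  split; last by rewrite -(path_label_value hT e) upd_in.
  exact: same_stage_trans (same_stage_upd w s) (path_label_same_stage hT e).
apply: (same_stage_path_label hT); last by rewrite upd_in.
by apply: same_stage_trans st; rewrite same_stage_sym same_stage_upd.
Qed.

Lemma mem_labels_same_stage j x u :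
  path_label x j \in labels theta (prefix j u) -> same_stage j x u.
Proof.
case/imsetP => s _ e.
have e2 : path_label (upd u s) j = theta (prefix j u) s.
  rewrite /Defs.path_label upd_in; congr (theta _ s).
  by apply/eqP; rewrite eq_sym prefix_eq agree_below_upd.
have := path_label_upd x u s.
by rewrite e2 -e eqxx same_stage_sym => /esym/andP[].
Qed.

(* The labels of level j are set to 1 on Q and to 0 outside: this picks
   coefficients of the polynomials t with respect to the level j. *)
Definition level_mask y j (Q : {set L}) l :=
  if [exists x, path_label x j == l] then (l \in Q)%:R else y l.

Lemma tail_mask y j (Q : {set L}) x :
  tail (level_mask y j Q) j x = \sum_(s < d j)
    (path_label (upd x s) j \in Q)%:R * tail y j.+1 (upd x s).
Proof.
rewrite tail_rec; apply: eq_bigr => s _; congr (_ * _).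
  rewrite /level_mask ifT //; by apply/existsP; exists (upd x s).
apply: eq_tail => z i ji; rewrite /level_mask ifF //; apply/negbTE/existsPn => w.
apply: contraTneq ji => /(path_label_level hT) ->.
by rewrite ltnn.
Qed.

(** Keeping one label of level [j] extracts its coefficient. *)
Lemma tail_mask1 y j x w : same_stage j w x ->
  tail (level_mask y j [set path_label x j]) j w = tail y j.+1 (upd w (x j)).
Proof.
move=> st; rewrite tail_mask (bigD1 (x j)) //= in_set1 path_label_upd st eqxx mul1r.
rewrite big1 ?addr0 // => s /negbTE sx.
by rewrite in_set1 path_label_upd sx andbF mul0r.
Qed.

(** The second label belongs to another stage, so it does not occur on the edges leaving the vertex
    of [w]. *)
Lemma tail_mask2 y j x x' w : same_stage j w x -> ~~ same_stage j x x' ->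
  tail (level_mask y j [set path_label x j; path_label x' j]) j w
    = tail y j.+1 (upd w (x j)).
Proof.
move=> st nst; rewrite tail_mask (bigD1 (x j)) //= in_set2 path_label_upd st eqxx mul1r.
rewrite big1 ?addr0 // => s /negbTE sx.
rewrite in_set2 !path_label_upd sx andbF.
case: (boolP (same_stage j w x')) => [wx'|]; last by rewrite mul0r.
by move: nst; rewrite same_stage_sym in st; rewrite (same_stage_trans st wx').
Qed.

Lemma tail_mask3 y j x x' w : same_stage j w x -> same_stage j w x' -> x j != x' j ->
  tail (level_mask y j [set path_label x j; path_label x' j]) j w
    = tail y j.+1 (upd w (x j)) + tail y j.+1 (upd w (x' j)).
Proof.
move=> st st' nx; rewrite tail_mask (bigD1 (x j)) //= (bigD1 (x' j)) 1?eq_sym //=.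
rewrite !in_set2 !path_label_upd st st' !eqxx orbT /= !mul1r.
rewrite big1 ?addr0 // => s /andP[/negbTE sx /negbTE sx'].
by rewrite in_set2 !path_label_upd sx sx' !andbF mul0r.
Qed.

(** This is t(ab) t(a'b') = t(ab') t(a'b) evaluated at [y]. All real [y] are allowed, so that masks
    with zeros can be substituted. *)
Definition tail_factors n c B := forall y x x', extends c x -> extends c x' ->
  tail y n x * tail y n x' = tail y n (swap B x x') * tail y n (swap B x' x).

Definition stage_indep j c B := forall x x', extends c x -> extends c x' ->
  same_stage j x (swap B x x').

(** If only the labels in the stages of the two swaps are kept, the right-hand side is positive.
    Hence one of these labels also occurs on an edge at the vertex of [x]. *)
Lemma tail_factors_stage j c B x x' : tail_factors j c B ->
  extends c x -> extends c x' ->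
  same_stage j x (swap B x x') || same_stage j x (swap B x' x).
Proof.
move=> fac hx hx'; set u := swap B x x'; set u' := swap B x' x.
pose Q := labels theta (prefix j u) :|: labels theta (prefix j u').
pose y (l : L) : R := 1.
have tail_gt0' w : path_label w j \in Q -> 0 < tail (level_mask y j Q) j w.
  move=> wQ; rewrite tail_mask (bigD1 (w j)) //= upd_id wQ mul1r.
  apply: ltr_wpDr; last by apply: tail_gt0 => l; apply: ltr01.
  apply: sumr_ge0 => s _; rewrite mulr_ge0 ?ler0n //.
  by apply/ltW/tail_gt0 => l; apply: ltr01.
have := fac (level_mask y j Q) x x' hx hx'; rewrite -/u -/u' => e.
have : 0 < tail (level_mask y j Q) j x * tail (level_mask y j Q) j x'.
  by rewrite e mulr_gt0 // tail_gt0' // in_setU mem_labels ?orbT.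
case: (boolP [exists s : 'I_(d j), path_label (upd x s) j \in Q]).
  case/existsP => s + _; rewrite in_setU.
  have stx := same_stage_upd x s.
  by case/orP => /mem_labels_same_stage /(same_stage_trans stx) ->; rewrite ?orbT.
move=> /existsPn nQ; rewrite tail_mask big1 ?mul0r ?ltxx // => s _.
by rewrite (negbTE (nQ s)) mul0r.
Qed.

Lemma tail_factors_step j c B : balanced R theta -> j \notin B -> j \notin dom c ->
  tail_factors j c B -> stage_indep j c B -> tail_factors j.+1 c B.
Proof.
move=> bal jB jc fac sti.
(* First case: equal labels at level [j], where a single label is kept. *)
have jump y x x' : extends c x -> extends c x' -> same_stage j x x' -> x j = x' j ->
    tail y j.+1 x * tail y j.+1 x'
      = tail y j.+1 (swap B x x') * tail y j.+1 (swap B x' x).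
  move=> hx hx' st xj.
  have st1 : same_stage j (swap B x x') x by rewrite same_stage_sym sti.
  have st2 : same_stage j (swap B x' x) x.
    rewrite same_stage_sym in st; apply: same_stage_trans st.
    by rewrite same_stage_sym sti.
  have := fac (level_mask y j [set path_label x j]) x x' hx hx'.
  rewrite !tail_mask1 ?same_stage_refl //; last by rewrite same_stage_sym.
  rewrite upd_id -!swap_updl // upd_id.
  by rewrite xj upd_id.
move=> y x x' hx hx'.
have st1 : same_stage j (swap B x x') x by rewrite same_stage_sym sti.
have st2 : same_stage j (swap B x' x) x' by rewrite same_stage_sym sti.
(* In different stages, the mask of both labels leaves one term in each factor. *)
case: (boolP (same_stage j x x')) => st; last first.
  have := fac (level_mask y j [set path_label x j; path_label x' j]) x x' hx hx'.
  have st' : ~~ same_stage j x' x by rewrite same_stage_sym.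
  rewrite (tail_mask2 y (same_stage_refl _ _ _) st) (tail_mask2 y st1 st).
  rewrite [[set _; _]]setUC (tail_mask2 y (same_stage_refl _ _ _) st') (tail_mask2 y st2 st').
  by rewrite -!swap_updl // !upd_id.
have [xj|nxj] := eqVneq (x j) (x' j); first exact: jump.
have stS : same_stage j x' x by rewrite same_stage_sym.
(* In one stage with different values, each side expands into four products. Two of them match by
   [jump]; the other two on each side are equal by balancedness, so each is half of their sum. *)
have := fac (level_mask y j [set path_label x j; path_label x' j]) x x' hx hx'.
rewrite !tail_mask3 ?same_stage_refl //; first last.
- exact: same_stage_trans st1 st.
- exact: same_stage_trans st2 stS.
have ext_upd z (s : 'I_(d j)) : extends c z -> extends c (upd z s).
  move=> hz; rewrite (extends_agree _ hz); apply: agree_sub (agree_upd z s).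
  by rewrite subsetC sub1set in_setC.
have e1 := jump y x (upd x' (x j)) hx (ext_upd _ _ hx')
  (same_stage_trans st (same_stage_upd _ _)) (esym (upd_in _ _)).
have e2 := jump y (upd x (x' j)) x' (ext_upd _ _ hx) hx'.
have {}e2 := e2 _ (upd_in _ _).
have {}e2 := e2 (same_stage_trans _ st).
have b1 := balanced_tail y bal st.
have b2 : same_stage j (swap B x x') (swap B x' x).
  by apply: (same_stage_trans st1 (same_stage_trans st _)); rewrite same_stage_sym.
have {}b2 := balanced_tail y bal b2.
move: e1 e2 b1 b2; rewrite !swap1 !swap_updl // !swap_updr // !upd_id.
rewrite !swapE (negbTE jB) same_stage_sym same_stage_upd => e1 /(_ isT) e2.
have -> : upd (swap B x x') (x j) = swap B x x' by rewrite -swap_updl // upd_id.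
have -> : upd (swap B x' x) (x' j) = swap B x' x by rewrite -swap_updl // upd_id.
move: e1 e2.
move: (tail _ _ _) (tail _ _ _) (tail _ _ _) (tail _ _ _) (tail _ _ _)
  (tail _ _ _) (tail _ _ _) (tail _ _ _) => t1 t2 t3 t4 t5 t6 t7 t8.
lra.
Qed.

End Separation.

(** * Construction of the separations inside J(T) *)

Section SeparationJT.
Variables (R : realType) (p : nat) (d : 'I_p -> nat) (L : finType)
  (theta : labeling d L).
Hypotheses (d_ge2 : forall i, (2 <= d i)%N) (hT : CStree theta)
  (bal : balanced R theta).
Implicit Types (x z w u : outcome d) (A B C : {set 'I_p})
  (c : passign d) (k j : 'I_p).

(** Makes [A] and [B] interchangeable: swapping one amounts to swapping the other in the reversed
    pair. *)
Lemma agree_swap_compl n c A B x x' : pairwise_disjoint [:: A; B; dom c] ->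
  A :|: B :|: dom c = below p n -> extends c x -> extends c x' ->
  agree (below p n) (swap A x x') (swap B x' x).
Proof.
move=> pd <- hx hx'; rewrite (extends_agree _ hx) in hx'.
have dAB : [disjoint A & B] by disj_tac.
have dC : [disjoint A :|: B & dom c] by disj_tac.
rewrite !agreeU; apply/andP; split; first (apply/andP; split); apply/agreeP => i iM;
  rewrite !swapE.
- by rewrite iM (disjointFr dAB).
- by rewrite iM (disjointFl dAB).
- have := disjointFl dC iM; rewrite in_setU => /norP[/negbTE -> /negbTE ->].
  exact: (agreeP _ _ _ hx').
Qed.

Lemma tail_factors_sym n c A B : pairwise_disjoint [:: A; B; dom c] ->
  A :|: B :|: dom c = below p n ->
  tail_factors R theta n c B -> tail_factors R theta n c A.
Proof.
move=> pd cov fac y x x' hx hx'.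
rewrite (tail_agree theta y (agree_swap_compl pd cov hx hx')).
rewrite (tail_agree theta y (agree_swap_compl pd cov hx' hx)) [RHS]mulrC.
exact: fac.
Qed.

(** Write g(a,b) for the stage of an outcome. By [tail_factors_stage], g(a,b) always equals g(a,b')
    or g(a',b). If g(a1,b1) differs from g(a1,b1') and g(a2,b2) from g(a2',b2), then g(a1,b1) =
    g(a2,b1) = g(a2,b2) = g(a2,b1') = g(a1,b1'), a contradiction. *)
Lemma stage_indep_either j c A B : pairwise_disjoint [:: A; B; dom c] ->
  A :|: B :|: dom c = below p j -> tail_factors R theta j c B ->
  stage_indep theta j c B \/ stage_indep theta j c A.
Proof.
move=> pd cov fac; have H := tail_factors_stage hT fac.
pose ext2 (u : outcome d * outcome d) := extends c u.1 && extends c u.2.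
case: (boolP [forall u, ext2 u ==> same_stage theta j u.1 (swap B u.1 u.2)]).
  move=> /forallP h; left=> x x' hx hx'.
  by have /implyP := h (x, x'); apply; apply/andP.
case/forallPn => -[x1 x1']; rewrite negb_imply /ext2 /= => /andP[/andP[hx1 hx1'] n1].
case: (boolP [forall u, ext2 u ==> same_stage theta j u.1 (swap B u.2 u.1)]).
  move=> /forallP h; right=> x x' hx hx'.
  have /implyP /= := h (x, x') => /(_ _) st.
  apply: same_stage_trans (st _) _; first exact/andP.
  apply: same_stage_agree; rewrite agree_sym.
  exact: agree_swap_compl pd cov hx hx'.
case/forallPn => -[x2 x2']; rewrite negb_imply /ext2 /= => /andP[/andP[hx2 hx2'] n2].
have st12 : same_stage theta j x1 (swap B x2 x1).
  have := H x1 (swap B x2 x1') hx1 (extends_swap B hx2 hx1').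
  have -> : swap B x1 (swap B x2 x1') = swap B x1 x1'.
    by apply/ffunP => i; rewrite !swapE; case: (i \in B).
  have -> : swap B (swap B x2 x1') x1 = swap B x2 x1.
    by apply/ffunP => i; rewrite !swapE; case: (i \in B).
  by rewrite (negbTE n1).
have st12' : same_stage theta j (swap B x1 x1') (swap B x2 x1').
  have := H (swap B x1 x1') (swap B x2 x1) (extends_swap B hx1 hx1')
    (extends_swap B hx2 hx1).
  have -> : swap B (swap B x1 x1') (swap B x2 x1) = x1.
    by apply/ffunP => i; rewrite !swapE; case: (i \in B).
  have -> : swap B (swap B x2 x1) (swap B x1 x1') = swap B x2 x1'.
    by apply/ffunP => i; rewrite !swapE; case: (i \in B).
  by rewrite same_stage_sym (negbTE n1).
(* g(a2,b) = g(a2,b2) for every b, as the alternative g(a2',b2) is excluded. *)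
have st2 z : extends c z -> same_stage theta j x2 (swap B x2 z).
  move=> hz; have := H x2 (swap B x2' z) hx2 (extends_swap B hx2' hz).
  have -> : swap B x2 (swap B x2' z) = swap B x2 z.
    by apply/ffunP => i; rewrite !swapE; case: (i \in B).
  have -> : swap B (swap B x2' z) x2 = swap B x2' x2.
    by apply/ffunP => i; rewrite !swapE; case: (i \in B).
  by rewrite (negbTE n2) orbF.
case/negP: n1; apply: same_stage_trans st12 _; rewrite same_stage_sym.
apply: same_stage_trans st12' _; rewrite same_stage_sym.
by apply: same_stage_trans (st2 _ hx1'); rewrite same_stage_sym st2.
Qed.

(** By absorption it suffices to fix the values on [A]. The stage statement at an outcome [x] with
    these values then gives the claim by weak union and specialization, once its context is known to
    avoid [B]. *)
Lemma JT_stage_indep j c A B : pairwise_disjoint [:: A; B; dom c] ->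
  A :|: B :|: dom c = below p j -> stage_indep theta j c B ->
  JT theta (CSI [set j] B A c).
Proof.
move=> pd cov sti.
have d1 : [disjoint [set j] & A :|: B :|: dom c] by rewrite cov disjoint1_below.
rewrite -[A in CSI _ _ A]set0U; apply: JT_absorption; first by disj_tac.
move=> xT; rewrite inE => /eqP dxT.
have [x hx] := exists_extends (glue c xT) (d_gt0 d_ge2).
have xP i : glue c xT i = if i \in dom c :|: A then Some (x i) else None.
  rewrite -dxT; case: ifPn; rewrite !inE.
    move=> h; apply: (extendsP _ _ hx); rewrite inE ffunE.
    by case: (c i) h.
  by rewrite ffunE => /norP[]; case: (c i) => // _; rewrite negbK => /eqP.
have hxc : extends c x.
  apply/extendsP => i ic; have := xP i; rewrite in_setU ic /= ffunE.
  by move: ic; rewrite inE; case: (c i).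
set c' := stage_context theta (prefix j x).
have subj : dom c' \subset below p j := dom_stage_context theta j x.
have hx' : extends c' x by rewrite extends_stage_context // same_stage_refl.
(* Changing a coordinate in [B] to a second value keeps the stage, so the context cannot fix it. *)
have c'B i : i \in B -> i \notin dom c'.
  move=> iB; apply/negP => ic'.
  have [s sx] := exists_ord_neq (x i) (d_ge2 i).
  have := sti x (upd x s) hxc.
  rewrite (extends_agree _ hxc) (agree_sub _ (agree_upd x s)) => [/(_ isT)|].
    rewrite -extends_stage_context // => /extendsP/(_ i ic').
    rewrite swapE iB upd_in (extendsP _ _ hx' i ic') => -[xs].
    by rewrite xs eqxx in sx.
  rewrite subsetC sub1set in_setC.
  have dBC : [disjoint B & dom c] by disj_tac.
  by rewrite (disjointFr dBC iB).
(* [E] collects the fixed coordinates that the stage context leaves free; they are specialized to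
   the values of [x]. *)
pose E := (dom c :|: A) :\: dom c'.
have eF : below p j :\: dom c' = B :|: E.
  rewrite -cov /E; apply/setP => i; have := c'B i; rewrite !(in_setU, in_setD).
  by case: (i \in B) => [/(_ isT) ->|_]; cases_mem.
have h0 := JT_stage theta (prefix j x); rewrite /stage_statement -/c' eF in h0.
have dE : [disjoint E & dom c'] by apply/disjP => i; rewrite in_setD; cases_mem.
have dBc' : [disjoint B & dom c'] by apply/disjP => i; have := c'B i; cases_mem => ->.
have dBE : [disjoint B & E].
  have dB : [disjoint B & dom c :|: A] by disj_tac.
  by apply: disjointWr dB; rewrite subsetDl.
have dj : [disjoint [set j] & B :|: E].
  by rewrite -eF; apply: disjointWr (disjoint1_below j); rewrite subsetDl.
have dj' : [disjoint [set j] & dom c'] by apply: disjointWr (disjoint1_below j).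
have h1 : JT theta (CSI [set j] B (finset.set0 :|: E) c').
  by apply: JT_weak_union h0; disj_tac.
have h2 : JT theta (CSI [set j] B ((finset.set0 :|: E) :\: E) (glue (restr E x) c')).
  apply: JT_specialization h1; first by disj_tac.
    exact: subsetUr.
  by rewrite inE dom_restr.
move: h2; rewrite set0U setDv.
suff -> : glue (restr E x) c' = glue c xT by [].
apply/ffunP => i; rewrite xP ffunE [restr E x i]ffunE in_setD.
case: (boolP (i \in dom c')) => ic' /=.
  rewrite (extendsP _ _ hx' i ic').
  have := subsetP subj i ic'; rewrite -cov !in_setU.
  have := contraL (c'B i) ic'.
  by case: (i \in B) => // _; rewrite orbF orbC => ->.
case: ifP => // _; move: ic'; rewrite inE negbK => /eqP //.
Qed.

(** Contraction of B _||_ j | A, c with B _||_ A | c. *)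
Lemma JT_separation_step j c A B : pairwise_disjoint [:: A; B; dom c] ->
  A :|: B :|: dom c = below p j -> stage_indep theta j c B ->
  JT theta (CSI A B finset.set0 c) -> JT theta (CSI (j |: A) B finset.set0 c).
Proof.
move=> pd cov sti hAB; have hj := JT_stage_indep pd cov sti.
have d1 : [disjoint [set j] & A :|: B :|: dom c] by rewrite cov disjoint1_below.
have hBA : JT theta (CSI B A finset.set0 c).
  by apply: JT_symmetry hAB; disj_tac.
have hBj : JT theta (CSI B [set j] (finset.set0 :|: A) c).
  by rewrite set0U; apply: JT_symmetry hj; disj_tac.
by apply: JT_symmetry; last (apply: JT_contraction hBj hBA); disj_tac.
Qed.

(** The induction invariant over the levels. The tail identity for [B] alone suffices, by
    [tail_factors_sym]. *)
Definition separation n c A B :=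
  [/\ pairwise_disjoint [:: A; B; dom c], A :|: B :|: dom c = below p n,
      JT theta (CSI A B finset.set0 c) & tail_factors R theta n c B].

Lemma separation_sym n c A B : separation n c A B -> separation n c B A.
Proof.
case=> pd cov hJ fac; split; [by disj_tac|by rewrite [B :|: A]setUC| |].
  by apply: JT_symmetry hJ; disj_tac.
exact: tail_factors_sym fac.
Qed.

Lemma separation_step j c A B : separation j c A B -> stage_indep theta j c B ->
  separation j.+1 c (j |: A) B.
Proof.
case=> pd cov hJ fac sti.
have dj : [disjoint [set j] & A :|: B :|: dom c] by rewrite cov disjoint1_below.
split; [by disj_tac|by rewrite belowS -cov; set_tac|exact: JT_separation_step|].
apply: tail_factors_step => //.
  by rewrite -disjoints1; disj_tac.
by rewrite -disjoints1; disj_tac.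
Qed.

Lemma separation_stage k x : let c := stage_context theta (prefix k x) in
  separation k.+1 c (below p k :\: dom c) [set k].
Proof.
move=> c; have sC : dom c \subset below p k := dom_stage_context theta k x.
have dj := disjoint1_below k.
have dj1 : [disjoint [set k] & below p k :\: dom c].
  by apply: disjointWr dj; rewrite subsetDl.
have dj2 : [disjoint [set k] & dom c] by apply: disjointWr dj.
have dj3 : [disjoint below p k :\: dom c & dom c] by apply/disjP => i; cases_mem.
split.
- by disj_tac.
- by rewrite belowS; apply/setP => i; have := subsetP sC i; cases_mem => ->.
- by apply: JT_symmetry (JT_stage theta (prefix k x)); disj_tac.
move=> y z z'; rewrite !extends_stage_context // => xz xz'.
apply: balanced_tail => //; apply: same_stage_trans xz'.
by rewrite same_stage_sym.
Qed.

(** The variable of each further level joins the side on which its stages may depend; both sides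
    only grow. *)
Lemma separation_level k x n : (k < n <= p)%N ->
  let c := stage_context theta (prefix k x) in
  exists A B, [/\ separation n c A B, below p k \subset A :|: dom c & k \in B].
Proof.
move=> + c; elim: n => // n IHn /andP[]; rewrite ltnS leq_eqVlt => /predU1P[<- _|kn np].
  exists (below p k :\: dom c), [set k]; split; first exact: separation_stage.
    by apply/subsetP => i; cases_mem.
  exact: set11.
have [|A [B [sep sA kB]]] := IHn; first by rewrite kn ltnW.
have [pd cov _ fac] := sep.
have [|sti|sti] := @stage_indep_either (Ordinal np) c A B pd _ fac; first exact: cov.
  exists (Ordinal np |: A), B; split=> //.
    exact: (separation_step (j := Ordinal np) sep sti).
  by rewrite -setUA; apply: subset_trans sA (subsetUr _ _).
exists A, (Ordinal np |: B); split=> //; last by rewrite in_setU1 kB orbT.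
apply: separation_sym; apply: (separation_step (j := Ordinal np)) sti.
exact: separation_sym.
Qed.

(** The basic move: the separation at level [p] is saturated, and [B] misses the coordinates before
    [k] because they lie in [A] or in the context. *)
Lemma stage_swap k x : exists B, [/\ k \in B, [disjoint B & below p k] &
  forall z z', same_stage theta k x z -> same_stage theta k x z' ->
  saturated_polys theta (pvar R z * pvar R z'
                         - pvar R (swap B z z') * pvar R (swap B z' z))].
Proof.
have [|A [B [[pd cov hJ _] sA kB]]] := @separation_level k x p.
  by rewrite ltn_ord leqnn.
move: pd cov hJ sA; set c := stage_context _ _ => pd cov hJ sA.
exists B; split=> // [|z z' xz xz'].
  rewrite disjoint_sym; apply: disjointWl sA _; disj_tac.
exists (CSI A B finset.set0 c); split=> //.
  by rewrite /saturated /= setU0 cov below_full.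
exists z, z'; split=> //=.
- by apply/eqP; rewrite -/(extends c z) extends_stage_context.
- by apply/eqP; rewrite -/(extends c z') extends_stage_context.
- by apply/ffunP => i; rewrite !ffunE in_set0.
Qed.

End SeparationJT.

(** * Ideals and evaluations *)

Section Ideals.
Variable (A : comNzRingType).
Implicit Types (G : A -> Prop) (a q : A).

Lemma ideal_gen0 G : ideal_gen G 0.
Proof. by exists [::]; split=> //; rewrite big_nil. Qed.

Lemma mem_ideal_gen G q : G q -> ideal_gen G q.
Proof.
move=> Gq; exists [:: (1, q)]; rewrite big_seq1 mul1r; split=> // ag.
by rewrite inE => /eqP ->.
Qed.

Lemma ideal_genD G q q' : ideal_gen G q -> ideal_gen G q' -> ideal_gen G (q + q').
Proof.
case=> s [sG ->] [s' [sG' ->]]; exists (s ++ s'); rewrite big_cat; split=> // ag.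
by rewrite mem_cat => /orP[/sG|/sG'].
Qed.

Lemma ideal_genM G a q : ideal_gen G q -> ideal_gen G (a * q).
Proof.
case=> s [sG ->]; exists [seq (a * ag.1, ag.2) | ag <- s]; split.
  by move=> _ /mapP[ag /sG hag ->].
by rewrite big_map mulr_sumr; apply: eq_bigr => ag _; rewrite mulrA.
Qed.

Lemma ideal_gen_sum G (I : eqType) (r : seq I) (P : pred I) (F : I -> A) :
  (forall i, i \in r -> P i -> ideal_gen G (F i)) ->
  ideal_gen G (\sum_(i <- r | P i) F i).
Proof.
move=> h; rewrite big_seq_cond; apply: big_ind; first exact: ideal_gen0.
  exact: ideal_genD.
by move=> i /andP[]; apply: h.
Qed.

Lemma ideal_gen_sub G G' q :
  (forall g, G g -> ideal_gen G' g) -> ideal_gen G q -> ideal_gen G' q.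
Proof.
move=> sG [s [sGs ->]]; apply: ideal_gen_sum => ag /sGs /sG Gag _.
exact: ideal_genM.
Qed.

Lemma ideal_gen_trans G a b q :
  ideal_gen G (a - b) -> ideal_gen G (b - q) -> ideal_gen G (a - q).
Proof. by move=> h /(ideal_genD h); rewrite addrA subrK. Qed.

End Ideals.

(** * Linear independence of monomial functions *)

Lemma monomial_independence (R : realType) (L : finType)
    (E : seq {ffun L -> nat}) (c : {ffun L -> nat} -> R) : uniq E ->
  (forall y : L -> R, (forall l, 0 < y l) ->
     \sum_(e <- E) c e * \prod_l y l ^+ e l = 0) ->
  forall e, e \in E -> c e = 0.
Proof.
elim: E c => [|e0 E IHE] c //= /andP[e0E uE] h.
have c0 e : e \in E -> c e = 0.
  move=> eE; have [l0 nel0] : exists l0, e l0 != e0 l0.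
    apply/existsP; apply: contraR e0E => /existsPn ee0.
    suff -> : e0 = e by [].
    by apply/ffunP => l; have := ee0 l; rewrite negbK => /eqP.
  have ne2 : 2 ^+ e l0 - 2 ^+ e0 l0 != 0 :> R.
    rewrite subr_eq0; apply: contraNneq nel0 => /ieexprIn -> //.
    by rewrite (eqr_nat R 2 1).
  apply: (mulIf ne2); rewrite mul0r.
  pose c' (e : {ffun L -> nat}) : R := c e * (2 ^+ e l0 - 2 ^+ e0 l0).
  apply: (IHE c' uE) => // y y_gt0.
  (* Doubling the coordinate [l0] and subtracting 2^(e0 l0) times the original relation removes the
     term of [e0] and multiplies each other coefficient by a factor, nonzero for [e]. *)
  pose y' l := (if l == l0 then 2 else 1) * y l.
  have y'_gt0 l : 0 < y' l by rewrite mulr_gt0 //; case: ifP.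
  have y'E (e1 : {ffun L -> nat}) :
      \prod_l y' l ^+ e1 l = 2 ^+ e1 l0 * \prod_l y l ^+ e1 l.
    under eq_bigr => l _ do rewrite exprMn.
    rewrite big_split /=; congr (_ * _); rewrite (bigD1 l0) //= eqxx.
    by rewrite big1 ?mulr1 // => l /negbTE ->; rewrite expr1n.
  have := h y' y'_gt0; have := h y y_gt0; rewrite !big_cons y'E => h1 h2.
  transitivity ((c e0 * (2 ^+ e0 l0 * \prod_l y l ^+ e0 l)
      + \sum_(e1 <- E) c e1 * \prod_l y' l ^+ e1 l)
    - 2 ^+ e0 l0 * (c e0 * \prod_l y l ^+ e0 l
      + \sum_(e1 <- E) c e1 * \prod_l y l ^+ e1 l)); last by rewrite h1 h2 mulr0 subr0.
  transitivity (\sum_(e1 <- E) c e1 * \prod_l y' l ^+ e1 l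
    - 2 ^+ e0 l0 * \sum_(e1 <- E) c e1 * \prod_l y l ^+ e1 l); last by ring.
  rewrite mulr_sumr -sumrB; apply: eq_bigr => e1 _; rewrite y'E /c'; ring.
move=> e; rewrite inE => /predU1P[->|/c0 //].
(* Evaluation at the all-ones point leaves only the coefficient of [e0]. *)
have := h (fun=> 1) (fun=> ltr01); rewrite big_cons [X in _ + X]big_seq.
rewrite [X in _ + X]big1 => [|e1 /c0 ->]; last by rewrite mul0r.
by rewrite addr0 big1 ?mulr1 // => l _; rewrite expr1n.
Qed.

(** * Evaluation, and monomials as families of outcomes *)

Section Evaluation.
Variables (R : realType) (p : nat) (d : 'I_p -> nat).
Implicit Types (f : outcome d -> R) (q : pring R d).

Lemma peval_pvar f x : peval f (pvar R x) = f x.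
Proof. by rewrite /peval mevalXU enum_rankK. Qed.

Lemma peval_ideal_gen f (G : pring R d -> Prop) q :
  (forall g, G g -> peval f g = 0) -> ideal_gen G q -> peval f q = 0.
Proof.
move=> hG [s [sG ->]]; rewrite /peval rmorph_sum big_seq big1 // => ag /sG /hG.
by rewrite /peval rmorphM /= => ->; rewrite mulr0.
Qed.

Lemma peval_scale f a n q : q \is n.-homog ->
  peval (fun x => a * f x) q = a ^+ n * peval f q.
Proof.
move=> /dhomogP hq; rewrite /peval !mevalE mulr_sumr !big_seq; apply: eq_bigr => m mq.
rewrite mulrCA; congr (_ * _); under eq_bigr => i _ do rewrite exprMn.
rewrite big_split /=; congr (_ * _).
by rewrite -(hq m mq) /= mdegE -expr_sum.
Qed.

Lemma mpolyX_family (m : 'X_{1..#|outcome d|}) :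
  exists X : {ffun 'I_(mdeg m) -> outcome d}, 'X_[m] = \prod_i pvar R (X i).
Proof.
(* Each outcome is listed as often as its exponent says. *)
pose s := flatten [seq nseq (m i) (enum_val i) | i <- enum 'I_#|outcome d|].
have sz : size s = mdeg m.
  rewrite size_flatten /shape -map_comp sumnE big_map big_enum mdegE /=.
  by apply: eq_bigr => i _; rewrite size_nseq.
exists [ffun i => tnth (tcast sz (in_tuple s)) i].
under eq_bigr => i _ do rewrite ffunE.
rewrite -(big_tuple _ _ _ xpredT) val_tcast /= big_flatten big_map big_enum mpolyXE_id.
by apply: eq_bigr => i _; rewrite big_nseq /pvar enum_valK -Monoid.iteropE.
Qed.

End Evaluation.

(** * Connectivity of the fibres *)

Section Connectivity.
Variables (R : realType) (p : nat) (d : 'I_p -> nat) (L : finType)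
  (theta : labeling d L).
Hypotheses (d_ge2 : forall i, (2 <= d i)%N) (hT : CStree theta)
  (bal : balanced R theta).
Implicit Types (f : outcome d -> R) (y : L -> R) (x z w : outcome d)
  (k : 'I_p) (q : pring R d).

Local Notation polys := (saturated_polys (R := R) theta).

(** No normalization is assumed, so that weights are covered as well as model points. *)
Lemma saturated_polys_vanish f g : (forall x, 0 < f x) -> stage_invariant theta f ->
  polys g -> peval f g = 0.
Proof.
move=> f_gt0 inv [s [hs sat [x [x' [hx hx' hS ->]]]]].
have := JT_indep d_ge2 hT f_gt0 inv hs; have := pairwise_disjoint_JT hs.
case: s sat {hs} hx hx' hS => A B S c /= sat hx hx' hS pd ind.
have xx' : agree S x x'.
  apply/agreeP => i iS; have /ffunP/(_ i) := hS.
  by rewrite !ffunE iS => -[].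
have := indep_cross f_gt0 pd sat ind (introT eqP hx) (introT eqP hx') xx'.
rewrite /peval rmorphB !rmorphM /= => e.
by have := @peval_pvar R p d f; rewrite /peval => ev; rewrite !ev e subrr.
Qed.

Section Families.
Variable n : nat.
Implicit Types X Y : {ffun 'I_n -> outcome d}.

Definition fam_mon X : pring R d := \prod_i pvar R (X i).

(** Stands for equality of the multisets of labels, in a form preserved by congruence. *)
Definition same_weight X Y := forall y, (forall l, 0 < y l) ->
  \prod_i weight theta y (X i) = \prod_i weight theta y (Y i).

Lemma peval_fam_mon f X : peval f (fam_mon X) = \prod_i f (X i).
Proof.
rewrite /peval rmorph_prod; apply: eq_bigr => i _ /=.
exact: peval_pvar.
Qed.

Lemma congruent_same_weight X Y :
  ideal_gen polys (fam_mon X - fam_mon Y) -> same_weight X Y.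
Proof.
move=> h y y_gt0; have w_gt0 x := weight_gt0 theta x y_gt0.
have inv := weight_invariant hT y bal.
have := peval_ideal_gen (fun g => saturated_polys_vanish w_gt0 inv) h.
rewrite /peval rmorphB /= -!/(peval _ _) !peval_fam_mon => /eqP.
by rewrite subr_eq0 => /eqP.
Qed.

Lemma card_label X Y k x : same_weight X Y ->
  #|[set i | path_label theta (X i) k == path_label theta x k]|
    = #|[set i | path_label theta (Y i) k == path_label theta x k]|.
Proof.
move=> XY; set l := path_label theta x k.
(* A label occurs at most once on a path, so the product of weights is 2 to the number of paths
   containing [l]. *)
pose y (l' : L) : R := if l' == l then 2 else 1.
have y_gt0 l' : 0 < y l' by rewrite /y; case: ifP.
have wE z : weight theta y z = if path_label theta z k == l then 2 else 1.
  rewrite /weight (bigD1 k) //= big1 ?mulr1 // => j njk; rewrite /y ifN //.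
  by apply: contraNneq njk => /(path_label_level hT) ->.
have prodE (Z : {ffun 'I_n -> outcome d}) : \prod_i weight theta y (Z i)
    = 2 ^+ #|[set i | path_label theta (Z i) k == l]|.
  under eq_bigr => i _ do rewrite wE.
  rewrite -big_mkcond /= prodr_const; congr (_ ^+ _).
  by apply: eq_card => i; rewrite inE.
have := XY y y_gt0; rewrite !prodE => /ieexprIn; apply=> //.
by rewrite (eqr_nat R 2 1).
Qed.

Lemma swap_congruent (B : {set 'I_p}) X (a b : 'I_n) : a != b ->
  polys (pvar R (X a) * pvar R (X b)
         - pvar R (swap B (X a) (X b)) * pvar R (swap B (X b) (X a))) ->
  ideal_gen polys (fam_mon X - fam_mon [ffun i =>
    if i == a then swap B (X a) (X b)
    else if i == b then swap B (X b) (X a) else X i]).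
Proof.
move=> nab /mem_ideal_gen h; have nba : b != a by rewrite eq_sym.
have splitE Z : fam_mon Z = pvar R (Z a) * pvar R (Z b)
    * \prod_(i | (i != a) && (i != b)) pvar R (Z i).
  by rewrite /fam_mon (bigD1 a) // (bigD1 b) //= mulrA.
rewrite !splitE; set X' := finfun _.
have -> : \prod_(i | (i != a) && (i != b)) pvar R (X' i)
    = \prod_(i | (i != a) && (i != b)) pvar R (X i).
  by apply: eq_bigr => i /andP[/negbTE ia /negbTE ib]; rewrite ffunE ia ib.
rewrite !ffunE !eqxx (negbTE nba) -mulrBl mulrC; exact: ideal_genM.
Qed.

(** Induction on the number of indices with a wrong [k]-th coordinate: a single exchange repairs one
    of them and spoils none. *)
Lemma match_level k X Y : same_weight X Y ->
  (forall i, agree (below p k) (X i) (Y i)) ->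
  exists2 X', ideal_gen polys (fam_mon X - fam_mon X')
    & forall i, agree (below p k.+1) (X' i) (Y i).
Proof.
pose mismatch X := [set i | X i k != Y i k].
move: {2}#|mismatch X|.+1 (ltnSn #|mismatch X|) => m.
elim: m X => // m IHm X; rewrite ltnS => mX XY ag.
have [X0|[a aX]] := set_0Vmem (mismatch X).
  exists X; first by rewrite subrr; apply: ideal_gen0.
  move=> i; rewrite belowS agreeU ag andbT; apply/agreeP => j; rewrite inE => /eqP ->.
  by apply/eqP; apply: contraT => nk; have := in_set0 i; rewrite -X0 inE nk.
have naY : X a k != Y a k by move: aX; rewrite inE.
pose same (Z : {ffun 'I_n -> outcome d}) :=
  [set i | path_label theta (Z i) k == path_label theta (Y a) k].
have aSX : a \notin same X.
  by rewrite inE; apply: contraNneq naY => /(path_label_value hT) ->.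
(* The label wanted at [a] occurs equally often in both families. Since [X a] lacks it, some [X b]
   carries it where [Y b] does not. *)
have [b bX bY] : exists2 b, b \in same X & b \notin same Y.
  apply/subsetPn; apply: contra aSX => sXY.
  have /eqP -> : same X == same Y by rewrite eqEcard sXY (card_label k _ XY) leqnn.
  by rewrite inE.
have lb : path_label theta (X b) k = path_label theta (Y a) k by apply/eqP; rewrite inE in bX.
have stab : same_stage theta k (X a) (X b).
  apply: same_stage_trans (same_stage_agree theta (ag a)) _.
  by rewrite same_stage_sym; apply: path_label_same_stage.
have nbY : X b k != Y b k.
  apply: contraNneq bY => e; rewrite inE -lb; apply/eqP/esym/path_label_agree.
  by rewrite belowS agreeU ag andbT; apply/agreeP => j; rewrite inE => /eqP ->.
have nab : a != b by apply: contraNneq aSX => ->.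
have [B [kB dB swB]] := stage_swap d_ge2 hT bal k (X a).
have agsw x x' : agree (below p k) x (swap B x x').
  by apply/agreeP => i ik; rewrite swapE (disjointFl dB ik).
have := swap_congruent nab (swB _ _ (same_stage_refl _ _ _) stab).
set X1 := finfun _ => cong.
have ag1 i : agree (below p k) (X1 i) (Y i).
  rewrite ffunE; case: eqVneq => [->|_].
    by apply: agree_trans (ag a); rewrite agree_sym agsw.
  case: eqVneq => [->|_] //.
  by apply: agree_trans (ag b); rewrite agree_sym agsw.
(* The index [a] is now correct, and [b] was already a mismatch. *)
have m1 : (#|mismatch X1| < m)%N.
  apply: leq_trans mX; apply: proper_card; apply/properP; split.
    apply/subsetP => i; rewrite !inE ffunE; case: (eqVneq i a) => [->|_] //.
    by case: (eqVneq i b) => [->|_].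
  exists a; first by rewrite inE.
  rewrite inE negbK ffunE eqxx swapE kB; apply/eqP.
  exact: (path_label_value hT).
have XY1 : same_weight X1 Y.
  move=> y y_gt0; rewrite -(XY y y_gt0); apply/esym.
  exact: congruent_same_weight cong y y_gt0.
have [X' h' ag'] := IHm X1 m1 XY1 ag1.
by exists X' => //; apply: ideal_gen_trans h'.
Qed.

Lemma same_weight_congruent X Y : same_weight X Y ->
  ideal_gen polys (fam_mon X - fam_mon Y).
Proof.
move=> XY.
suff levels m : (m <= p)%N -> exists2 X', ideal_gen polys (fam_mon X - fam_mon X')
    & forall i, agree (below p m) (X' i) (Y i).
  have [X' h ag] := levels p (leqnn p).
  suff <- : X' = Y by [].
  by apply/ffunP => i; apply/eqP; rewrite -agreeT -below_full.
elim: m => [_|m IHm mp].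
  exists X; first by rewrite subrr; apply: ideal_gen0.
  by move=> i; rewrite below0; apply/agreeP => j; rewrite in_set0.
have [X1 h1 ag1] := IHm (ltnW mp).
have XY1 : same_weight X1 Y.
  move=> y y_gt0; rewrite -(XY y y_gt0); apply/esym.
  exact: congruent_same_weight h1 y y_gt0.
have [X' h' ag'] := match_level (k := Ordinal mp) XY1 ag1.
by exists X' => //; apply: ideal_gen_trans h'.
Qed.

End Families.

(** * The vanishing ideal *)

Definition label_count x : {ffun L -> nat} :=
  [ffun l => #|[set k | path_label theta x k == l]|].

(** The exponent vector of the image of a monomial under the toric parametrization. *)
Definition label_exponent (m : 'X_{1..#|outcome d|}) : {ffun L -> nat} :=
  [ffun l => (\sum_i m i * label_count (enum_val i) l)%N].

Lemma weight_label_count y x : weight theta y x = \prod_l y l ^+ label_count x l.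
Proof.
rewrite /weight (partition_big (fun k => path_label theta x k) xpredT) //=.
apply: eq_bigr => l _; rewrite ffunE.
rewrite (eq_bigr (fun=> y l)) => [|k /eqP -> //].
by rewrite prodr_const; congr (_ ^+ _); apply: eq_card => k; rewrite inE.
Qed.

Lemma peval_weightX y (m : 'X_{1..#|outcome d|}) :
  peval (weight theta y) 'X_[m] = \prod_l y l ^+ label_exponent m l.
Proof.
rewrite /peval mevalX /=.
under eq_bigr => i _ do rewrite weight_label_count -prodrXl.
rewrite exchange_big; apply: eq_bigr => l _; rewrite ffunE expr_sum.
by apply: eq_bigr => i _; rewrite -exprM mulnC.
Qed.

Lemma monomial_congruent (m m' : 'X_{1..#|outcome d|}) :
  mdeg m = mdeg m' -> label_exponent m = label_exponent m' ->
  ideal_gen polys ('X_[m] - 'X_[m']).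
Proof.
move=> em ee; have [X eX] := mpolyX_family R m; have [Y eY] := mpolyX_family R m'.
move: Y eY; rewrite -em => Y eY; rewrite eX eY.
apply: same_weight_congruent => y _; rewrite -!peval_fam_mon /fam_mon -eX -eY.
by rewrite !peval_weightX ee.
Qed.

(** The monomials of [q] are grouped by [label_exponent]. By independence the coefficients of each
    group sum to 0, so the group is a combination of differences with a fixed member [m0]. *)
Lemma vanishing_ideal n q : q \is n.-homog ->
  (forall y, (forall l, 0 < y l) -> peval (weight theta y) q = 0) ->
  ideal_gen polys q.
Proof.
move=> /dhomogP hq hv.
pose E := undup [seq label_exponent m | m <- msupp q].
have partE (V : nmodType) (F : 'X_{1..#|outcome d|} -> V) :
    \sum_(m <- msupp q) F m
      = \sum_(e <- E) \sum_(m <- msupp q | label_exponent m == e) F m.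
  under [RHS]eq_bigr => e _ do rewrite big_mkcond.
  rewrite exchange_big big_seq [RHS]big_seq; apply: eq_bigr => m mq /=.
  rewrite (bigD1_seq (label_exponent m)) ?undup_uniq //=; last first.
    by rewrite mem_undup map_f.
  by rewrite eqxx big1 ?addr0 // => e; rewrite eq_sym => /negbTE ->.
pose c e := \sum_(m <- msupp q | label_exponent m == e) q@_m.
have c0 : forall e, e \in E -> c e = 0.
  apply: monomial_independence (undup_uniq _) _ => y y_gt0.
  rewrite -[RHS](hv y y_gt0) [in RHS](mpolyE q) partE /peval rmorph_sum.
  apply: eq_bigr => e _; rewrite rmorph_sum mulr_suml; apply: eq_bigr => m /eqP <-.
  by rewrite /= mevalZ -/(peval _ _) peval_weightX.
rewrite [q]mpolyE partE; apply: ideal_gen_sum => e eE _.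
have [m0 m0q e0] : exists2 m0, m0 \in msupp q & e = label_exponent m0.
  by apply/mapP; rewrite -mem_undup.
have -> : \sum_(m <- msupp q | label_exponent m == e) q@_m *: 'X_[m]
    = \sum_(m <- msupp q | label_exponent m == e) (q@_m)%:MP * ('X_[m] - 'X_[m0]).
  under [RHS]eq_bigr => m _ do rewrite mul_mpolyC scalerBr.
  by rewrite sumrB -scaler_suml -/(c e) c0 // scale0r subr0.
apply: ideal_gen_sum => m mq /eqP em; apply: ideal_genM.
by apply: monomial_congruent; rewrite ?em -?e0 // !(hq _ _).
Qed.

Lemma homogeneous_vanishing_ideal q :
  homogeneous_vanishing theta q -> ideal_gen polys q.
Proof.
case=> -[n hq] hv; apply: (vanishing_ideal hq) => y y_gt0.
have w_gt0 x := weight_gt0 theta x y_gt0.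
(* The weight divided by [Z] lies in the model, and homogeneity removes the factor. *)
pose Z := \sum_x weight theta y x.
have [x0 _] := exists_extends [ffun i => None] (d_gt0 d_ge2).
have Z_gt0 : 0 < Z.
  by rewrite /Z (bigD1 x0) //= ltr_wpDr // sumr_ge0 // => x _; apply: ltW.
have fmod : in_model theta (fun x => Z^-1 * weight theta y x).
  apply: invariant_in_model => //; last exact/invariant_scale/weight_invariant.
  split=> [x|]; first by rewrite mulr_gt0 ?invr_gt0.
  by rewrite -mulr_sumr mulVf // lt0r_neq0.
have := hv _ fmod; rewrite (peval_scale _ _ hq) => /eqP.
by rewrite mulf_eq0 expf_eq0 invr_eq0 (negbTE (lt0r_neq0 Z_gt0)) andbF /= => /eqP.
Qed.

(** Products of marginals are sums over pairs of outcomes; exchanging [B] is an involution on pairs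
    that carries one sum to the other, and the vanishing binomials match the summands. *)
Lemma vanishing_invariant f : (forall g, polys g -> peval f g = 0) ->
  stage_invariant theta f.
Proof.
move=> hv; apply: marg_invariant => k x x' st.
have [B [kB dB swB]] := stage_swap d_ge2 hT bal k x.
have cross z z' : same_stage theta k x z -> same_stage theta k x z' ->
    f z * f z' = f (swap B z z') * f (swap B z' z).
  move=> xz xz'; apply/eqP; rewrite -subr_eq0 -(hv _ (swB _ _ xz xz')).
  by rewrite /peval rmorphB !rmorphM /= -!/(peval _ _) !peval_pvar.
have margM (u v : outcome d) : marg f (below p k.+1) u * marg f (below p k.+1) v =
    \sum_(zz : outcome d * outcome d | agree (below p k.+1) u zz.1
                              && agree (below p k.+1) v zz.2) f zz.1 * f zz.2.
  by rewrite /marg big_distrlr pair_big.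
have agB (u v z z' : outcome d) : agree (below p k.+1) u z ->
    agree (below p k.+1) v z' ->
    agree (below p k.+1) (swap [set k] u v) (swap B z z').
  move=> /agreeP uz /agreeP vz'; apply/agreeP => i ik; rewrite !swapE in_set1.
  move: (ik); rewrite belowS in_setU1; case: eqVneq => [-> _|_ /= ik'].
    by rewrite kB vz' // belowS setU11.
  by rewrite (disjointFl dB ik') uz.
have sw1K (u v : outcome d) : swap [set k] (swap [set k] u v) (swap [set k] v u) = u.
  exact: swapK.
rewrite !margM (reindex_inj (h := fun zz => (swap B zz.1 zz.2, swap B zz.2 zz.1))) /=.
  apply: eq_big => -[z z'] /=.
    apply/andP/andP => -[h1 h2]; split.
    - by have := agB _ _ _ _ h1 h2; rewrite swapK.
    - by have := agB _ _ _ _ h2 h1; rewrite swapK.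
    - by have := agB _ _ _ _ h1 h2; rewrite sw1K.
    - by have := agB _ _ _ _ h2 h1; rewrite sw1K.
  move=> /andP[h1 h2].
  have stz (u v : outcome d) : agree (below p k.+1) u v -> same_stage theta k u v.
    by move=> uv; apply: same_stage_agree; apply: agree_sub uv; rewrite belowS subsetUr.
  rewrite [LHS]cross ?swapK //; first exact: stz.
  exact: same_stage_trans st (stz _ _ h2).
move=> [z1 z2] [z1' z2'] /= [e1 e2]; congr (_, _).
  by rewrite -[LHS](swapK B z1 z2) e1 e2 swapK.
by rewrite -[LHS](swapK B z2 z1) e1 e2 swapK.
Qed.

Lemma finite_saturated_polys : cardinality.finite_set polys.
Proof.
(* A polynomial is determined by its two outcomes and the exchanged set, so finitely many occur. *)
pose F (u : outcome d * outcome d * {set 'I_p}) : pring R d :=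
  pvar R u.1.1 * pvar R u.1.2
    - pvar R (swap u.2 u.1.1 u.1.2) * pvar R (swap u.2 u.1.2 u.1.1).
apply: (@cardinality.sub_finite_set _ _ (classical_sets.image classical_sets.setT F)).
  by move=> g [s [_ _ [x [x' [_ _ _ ->]]]]]; exists (x, x', csi_right s).
exact/cardinality.finite_image/cardinality.finite_finset.
Qed.

Lemma saturated_polys_toric g : polys g -> homogeneous_vanishing theta g.
Proof.
move=> hg; split; last first.
  move=> f fm; apply: saturated_polys_vanish hg => [x|]; first exact: in_model_gt0 fm.
  exact: in_model_invariant.
case: hg => s [_ _ [x [x' [_ _ _ ->]]]]; exists 2.
have homog2 (u v : outcome d) : pvar R u * pvar R v \is 2.-homog.
  by rewrite /pvar -mpolyXD dhomogX /= mdegD !mdeg1.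
by rewrite rpredB.
Qed.

End Connectivity.

(** * Factorization criterion and Markov basis *)

Theorem theorem1p1 (R : realType) (p : nat) (d : 'I_p -> nat)
    (hd : forall i : 'I_p, (2 <= d i)%N)
    (L : finType) (theta : labeling d L)
    (hT : CStree theta) (hbal : balanced R theta) :
  (forall f : outcome d -> R, open_simplex f ->
     (in_model theta f <->
      forall g : pring R d, saturated_polys theta g -> peval f g = 0)) /\
  markov_basis theta (saturated_polys (R := R) theta).
Proof.
split=> [f fs|].
  split=> [fm g /(saturated_polys_toric hd hT)[_] |hv]; first exact.
  apply: invariant_in_model => //; exact: vanishing_invariant.
split.
- exact: finite_saturated_polys.
- move=> _ [s [_ _ [x [x' [_ _ _ ->]]]]]; rewrite /pvar -!mpolyXD.
  by exists (U_(enum_rank x) + U_(enum_rank x'))%MM, (U_(enum_rank (swap (csi_right s) x x'))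
    + U_(enum_rank (swap (csi_right s) x' x)))%MM.
- move=> q; split; apply: ideal_gen_sub => g.
    by move=> /(saturated_polys_toric hd hT) /mem_ideal_gen.
  exact: homogeneous_vanishing_ideal.
Qed.
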